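(* Let $V$ be a finite-dimensional real vector space with a (sufficiently) smooth norm $\|\cdot\|$ with unit ball $B$, such that the dual norm $\|\cdot\|_*$ on $V^*$ is also (sufficiently) smooth, and let $B^\circ\subset V^*$ be the unit ball of $\|\cdot\|_*$. Let $F$ be a $C^1$-smooth function on a convex body $K\subset V$. Then $$\max_{x\in K}F(x)-\min_{x\in K}F(x)\ \ge\ \frac12\, e(K\times B^\circ)\cdot\min_{x\in K}\|dF(x)\|_*,$$ where $e$ is the displacement energy in $V\times V^*$.
   Context: A convex body is a compact convex set with nonempty interior. A function is $C^1$-smooth on a convex body if it is the restriction of a real-valued $C^1$ function defined on an open neighborhood of the body; $dF(x)\in V^*$ is its differential. The space $V\times V^*$ carries the symplectic form $\omega((x_1,y_1),(x_2,y_2))=\langle x_1,y_2\rangle-\langle x_2,y_1\rangle$. For a smooth compactly supported time-dependent Hamiltonian $H(x,y,t)$ on $V\times V^*\times[T_1,T_2]$ its total oscillation is $$\|H\|=\int_{T_1}^{T_2}\Big(\sup_{x,y}H(x,y,t)-\inf_{x,y}H(x,y,t)\Big)\,dt .$$ Let $\phi_t$ be the Hamiltonian flow of $H$, with $\phi_{T_1}=\mathrm{id}$. The displacement energy $e(X)$ of $X\subset V\times V^*$ is the infimum of $\|H\|$ over all such $H$ (and all $[T_1,T_2]$) with $X\cap\phi_{T_2}(X)=\emptyset$. *)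

(* Defs.v *)
From HB Require Import structures.
From mathcomp Require Import all_boot all_order all_algebra.
From mathcomp Require Import all_classical all_reals all_analysis.

Set Implicit Arguments.
Unset Strict Implicit.
Unset Printing Implicit Defensive.

Import Order.TTheory GRing.Theory Num.Theory.
Import numFieldNormedType.Exports.

Local Open Scope classical_set_scope.
Local Open Scope ring_scope.

(* Finite-dimensional real normed spaces: the norm is [`|x|] and the topology
   is the one it induces. *)
#[short(type="finNormedModType")]
HB.structure Definition FinNormedModule (R : realType) :=
  {V of Vector R V & NormedModule R V}.

Section DualNorm.
Context {R : realType} {V : finNormedModType R}.
Implicit Types p q : 'Hom(V, R^o).

Definition dual_norm p : R := sup [set `|p x| | x in [set x : V | `|x| <= 1]].

Let n := \dim {:V}.
Let e (i : 'I_n) : V := (vbasis {:V})`_i.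
Let lc (c : 'rV[R]_n) : V := \sum_i c 0 i *: e i.

Let lcD c d : lc (c - d) = lc c - lc d.
Proof.
by rewrite /lc -sumrB; apply: eq_bigr => i _; rewrite !mxE scalerDl scaleNr.
Qed.

Let lcZ a c : lc (a *: c) = a *: lc c.
Proof.
by rewrite /lc scaler_sumr; apply: eq_bigr => i _; rewrite !mxE scalerA.
Qed.

Let lc_inj0 c : lc c = 0 -> c = 0.
Proof.
move=> c0; apply/rowP => i; rewrite mxE.
by have /freeP := basis_free (vbasisP {:V}); apply; exact: c0.
Qed.

Let lc_coord x : x = lc (\row_i coord (vbasis {:V}) i x).
Proof.
rewrite [LHS](coord_vbasis (memvf x)); apply: eq_bigr => i _.
by rewrite mxE.
Qed.

Let lin_bound (W : normedModType R) (f : {linear V -> W}) (c : 'rV[R]_n) :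
  `|f (lc c)| <= (\sum_i `|f (e i)|) * `|c|.
Proof.
rewrite linear_sum mulr_suml (le_trans (ler_norm_sum _ _ _))//.
apply: ler_sum => i _; rewrite linearZ normrZ mulrC ler_wpM2l//.
rewrite [leRHS]mx_normrE.
exact: (le_bigmax _ (fun i : 'I_1 * 'I_n => `|c i.1 i.2|) (0, i)).
Qed.

Let lc_bound c : `|lc c| <= (\sum_i `|e i|) * `|c|.
Proof. exact: (lin_bound idfun). Qed.

Let lc_norm_continuous : continuous (fun c => `|lc c|).
Proof.
move=> c; apply/(@cvgrPdist_le _ _ _ (nbhs c)) => eps eps0.
set M := \sum_i `|e i|.
have M0 : 0 <= M by apply: sumr_ge0.
have M1 : 0 < M + 1 by rewrite ltr_wpDl.
near=> d.
rewrite (le_trans (ler_dist_dist _ _))// -lcD (le_trans (lc_bound _))//.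
have : `|c - d| <= eps / (M + 1).
  near: d; apply/(@nbhs_normP R 'rV[R]_n); exists (eps / (M + 1)); first exact: divr_gt0.
  by move=> d /ltW.
rewrite ler_pdivlMr// mulrC; apply: le_trans.
by rewrite ler_wpM2r// lerDl.
Unshelve. all: by end_near. Qed.

Let lc_lower : exists2 C : R, 0 <= C & forall c, `|c| <= C * `|lc c|.
Proof.
have [[c0 c01]|S0] := pselect (exists c : 'rV[R]_n, `|c| = 1); last first.
  exists 0 => // c; have [->|cN0] := eqVneq c 0; first by rewrite normr0 mul0r.
  exfalso; apply: S0; exists (`|c|^-1 *: c).
  by rewrite normrZ normfV normr_id mulVf// normr_eq0.
pose S := [set c : 'rV[R]_n | `|c| = 1].
have cS : compact S.
  apply: bounded_closed_compact.
    by exists 1; split => // x x1 c /= ->; exact: ltW.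
  apply: (@closed_comp _ _ _ [set 1 : R]); last exact: closed_eq.
  by move=> x _; exact: norm_continuous.
have S0 : S !=set0 by exists c0.
have [c /= Sc cmin] := compact_EVT_min S0 cS (continuous_subspaceT lc_norm_continuous).
have m0 : 0 < `|lc c|.
  rewrite normr_gt0; apply/eqP => /lc_inj0 c_0.
  by move: Sc; rewrite inE /S/= c_0 normr0 => /esym/eqP; rewrite oner_eq0.
exists `|lc c|^-1; first by rewrite invr_ge0.
move=> d; have [->|dN0] := eqVneq d 0; first by rewrite normr0 mulr_ge0.
have d0 : 0 < `|d| by rewrite normr_gt0.
have /cmin : `|d|^-1 *: d \in S.
  by rewrite inE /S/= normrZ normfV normr_id mulVf// gt_eqF.
rewrite lcZ normrZ normfV normr_id => h.
by rewrite mulrC ler_pdivlMr// mulrC -ler_pdivlMr// mulrC.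
Qed.

(* A linear map on a finite-dimensional normed space is bounded. *)
Lemma linear_bounded (W : normedModType R) (f : {linear V -> W}) :
  exists2 C : R, 0 <= C & forall x, `|f x| <= C * `|x|.
Proof.
have [C C0 lcC] := lc_lower.
exists ((\sum_i `|f (e i)|) * C); first by rewrite mulr_ge0// sumr_ge0.
move=> x; rewrite [in leLHS](lc_coord x) (le_trans (lin_bound _ _))//.
by rewrite -mulrA ler_wpM2l ?sumr_ge0// [in leRHS](lc_coord x).
Qed.

Let has_sup_dual_norm p :
  has_sup [set `|p x| | x in [set x : V | `|x| <= 1]].
Proof.
split; first by exists `|p 0|; exists 0 => //=; rewrite normr0.
have [C C0 pC] := @linear_bounded R^o p.
exists C => _ [x /= x1 <-]; apply: (le_trans (pC x)).
by rewrite -[leRHS]mulr1 ler_wpM2l.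
Qed.

Lemma dual_norm_le p x : `|p x| <= dual_norm p * `|x|.
Proof.
have [->|xN0] := eqVneq x 0; first by rewrite linear0 !normr0 mulr0.
have x0 : 0 < `|x| by rewrite normr_gt0.
rewrite -ler_pdivrMr//.
apply: (sup_ubound (has_sup_dual_norm p).2); exists (`|x|^-1 *: x) => /=.
  by rewrite normrZ normfV normr_id mulVf// gt_eqF.
by rewrite linearZ/= normrZ normfV normr_id mulrC.
Qed.

Lemma dual_norm_lub p C : (forall x, `|x| <= 1 -> `|p x| <= C) ->
  dual_norm p <= C.
Proof.
move=> pC; apply: ge_sup; first exact: (has_sup_dual_norm p).1.
by move=> _ [x /= x1 <-]; exact: pC.
Qed.

Lemma dual_norm_ge0 p : 0 <= dual_norm p.
Proof.
apply: (sup_ubound (has_sup_dual_norm p).2).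
by exists 0 => /=; rewrite ?linear0 normr0.
Qed.

Fact ler_dual_normD p q : dual_norm (p + q) <= dual_norm p + dual_norm q.
Proof.
apply: dual_norm_lub => x x1; rewrite lfunE/= (le_trans (ler_normD _ _))//.
by apply: lerD; (apply: le_trans (dual_norm_le _ _) _;
  rewrite -[leRHS]mulr1 ler_wpM2l// dual_norm_ge0).
Qed.

Fact dual_normZ (a : R) p : dual_norm (a *: p) = `|a| * dual_norm p.
Proof.
have le b q : dual_norm (b *: q) <= `|b| * dual_norm q.
  apply: dual_norm_lub => x x1; rewrite lfunE/= normrZ ler_wpM2l//.
  by rewrite (le_trans (dual_norm_le _ _))// -[leRHS]mulr1 ler_wpM2l//
    dual_norm_ge0.
apply/eqP; rewrite eq_le le/=.
have [->|aN0] := eqVneq a 0; first by rewrite normr0 mul0r dual_norm_ge0.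
have a0 : 0 < `|a| by rewrite normr_gt0.
by rewrite mulrC -ler_pdivlMr// -[p in leLHS](scalerK aN0) mulrC -normfV le.
Qed.

Fact dual_norm0_eq0 p : dual_norm p = 0 -> p = 0.
Proof.
move=> p0; apply/lfunP => x; rewrite zero_lfunE; apply/eqP.
by rewrite -normr_le0 (le_trans (dual_norm_le _ _))// p0 mul0r.
Qed.

HB.instance Definition _ := Lmodule_isNormed.Build R 'Hom(V, R^o)
  ler_dual_normD dual_normZ dual_norm0_eq0.

End DualNorm.

Definition convex_body (R : realType) (V : finNormedModType R) (K : set V) :
    Prop :=
  [/\ compact K, convex_set K & K° !=set0].

Section Smooth.
Context {R : realType} {E W : normedModType R}.

(* [C^k] on an open subset [U] of a finite-dimensional space [E]: since [E] is
   finite-dimensional, [x |-> 'd f x] is [C^k] as soon as [x |-> 'd f x v] is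
   for every fixed vector [v]. *)
Fixpoint Ck (k : nat) (U : set E) (f : E -> W) : Prop :=
  if k is k'.+1 then
    (forall x, U x -> differentiable f x) /\
    (forall v, Ck k' U (fun x => 'd f x v))
  else forall x, U x -> {for x, continuous f}.

Definition smooth (U : set E) (f : E -> W) : Prop := forall k, Ck k U f.

End Smooth.

(* [F] is [C^1]-smooth on [K], with differential [dF x] at each [x \in K];
   only the restrictions of [F] and [dF] to [K] are relevant. *)
Definition C1_on_body (R : realType) (V : finNormedModType R) (K : set V)
    (F : V -> R^o) (dF : V -> 'Hom(V, R^o)) : Prop :=
  exists (U : set V) (G : V -> R^o),
    [/\ open U, K `<=` U, Ck 1 U G &
        forall x, K x -> G x = F x /\ linfun ('d G x) = dF x].

(* A norm is never differentiable at the origin of a nonzero space. *)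
Definition Ck_norm (R : realType) (E : normedModType R) (k : nat) : Prop :=
  Ck k [set x : E | x != 0] (fun x => `|x| : R^o).

Section DisplacementEnergy.
Context {R : realType} {V : finNormedModType R}.
Notation phase_space := (V * 'Hom(V, R^o))%type.
Implicit Types (H : phase_space * R^o -> R^o) (T : R).
Implicit Types phi : R -> phase_space -> phase_space.

Definition omega (z w : phase_space) : R := w.2 z.1 - z.2 w.1.

(* Time-dependent Hamiltonians [H (z, t)], of which only the values with [t]
   in [`[T1, T2]] are relevant; as for functions on a body, smoothness on
   [V x V^* x [T1, T2]] is that of an extension to an open neighborhood. *)
Definition hamiltonian T1 T2 H : Prop :=
  (exists2 U : set (phase_space * R^o),
     open U /\ (forall z t, T1 <= t <= T2 -> U (z, t)) & smooth U H) /\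
  (exists2 C : set phase_space, compact C &
     forall z t, T1 <= t <= T2 -> ~ C z -> H (z, t) = 0).

Definition total_oscillation T1 T2 H : \bar R :=
  (\int[lebesgue_measure]_(t in `[T1, T2])
     (sup (range (fun z => H (z, t))) - inf (range (fun z => H (z, t))))%:E)%E.

(* [phi t] is the flow of the vector field [X_t] such that
   [omega X_t w = d H_t w] for all [w]. *)
Definition hamiltonian_flow T1 T2 H phi : Prop :=
  [/\ forall z, phi T1 z = z,
      forall z, {within `[T1, T2], continuous (phi ^~ z)} &
      forall z t, T1 < t < T2 ->
        derivable (phi ^~ z) t 1 /\
        forall w, omega (derive1 (phi ^~ z) t) w =
                  'd (fun z' => H (z', t)) (phi t z) w].

Definition displacement_energy (X : set phase_space) : \bar R :=
  ereal_inf [set E | exists T1 T2 H phi,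
    [/\ T1 < T2, hamiltonian T1 T2 H, hamiltonian_flow T1 T2 H phi,
        X `&` phi T2 @` X = set0 & E = total_oscillation T1 T2 H]].

End DisplacementEnergy.

Section Extrema.
Context {R : realType}.
Implicit Types (A : set R) (m : R).

Definition is_max A m : Prop := A m /\ ubound A m.
Definition is_min A m : Prop := A m /\ lbound A m.

End Extrema.

(* Main.v *)
Require Import Defs.
From mathcomp Require Import all_boot all_order all_algebra.
From mathcomp Require Import all_classical all_reals all_analysis.
From mathcomp Require Import ring lra.

(** The inequality says that [F] generates an efficient displacement. Let [m]
    be the minimum of the norm of [dF] on [K] and [D] the oscillation of [F].
    The Hamiltonian [c * F x] on the cotangent space has the explicit flow
    [(x, y) |-> (x, y - t * c * dF x)]. Its time-one map translates the dual
    unit ball over each point [x] of [K] by a vector of norm at least [c * m],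
    hence off itself as soon as [c * m > 2], while its oscillation over [K] is
    [c * D]. Letting [c] decrease to [2 / m] bounds the displacement energy by
    [2 * D / m], which is the claim; if [m = 0] there is nothing to prove.

    Two points need work, because the Hamiltonians that compete in the
    definition of the displacement energy are smooth, compactly supported and
    must have a flow defined everywhere.

    First, [F] is only [C^1], and only near [K]. It is replaced by a compactly
    supported smooth function whose differential is uniformly close to [dF] on
    [K] and whose range exceeds that of [F] on [K] by arbitrarily little
    ([smooth_C1_approx]): Taylor polynomials of [F] at points of [K] are glued
    with a fine smooth partition of unity ([partition_of_unity]). Convexity of
    [K] gives the uniform Taylor estimate.

    Second, the Hamiltonian is cut off in the fibers by a bump function equal
    to [1] on a large ball. The trajectories that start in the product of [K]
    and the dual ball stay where the bump is [1], so they are not affected; the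
    other trajectories exist because the Hamiltonian vector field is bounded and
    Lipschitz ([picard], [product_flow]). The cut-off multiplies the Hamiltonian
    by a factor between [0] and [1], so it preserves a nonpositive lower bound
    and a nonnegative upper bound ([displacement_energy_le]). *)

Set Implicit Arguments.
Unset Strict Implicit.
Unset Printing Implicit Defensive.

Import Order.TTheory GRing.Theory Num.Theory.
Import numFieldNormedType.Exports.

Local Open Scope classical_set_scope.
Local Open Scope ring_scope.

(** * Calculus of smooth functions *)

Section SmoothBasics.
Context {R : realType} {E W : normedModType R}.
Implicit Types (f : E -> W) (k : nat).

Lemma CkS k (f : E -> W) : Ck k.+1 setT f -> Ck k setT f.
Proof.
elim: k f => [|k IH] f /= [df ddf].
  by move=> x _; apply: differentiable_continuous; exact: df.
by split=> // v; apply: IH; exact: ddf.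
Qed.

Lemma CkSP k (f : E -> W) : Ck k.+1 setT f <->
  (forall x, differentiable f x) /\ (forall v, Ck k setT (fun x => 'd f x v)).
Proof. by split=> -[df ddf]; split=> // x; apply: df. Qed.

Lemma Ck_cst k (a : W) : Ck k setT (fun _ : E => a).
Proof.
elim: k a => [|k IH] a /=; first by move=> x _; exact: cst_continuous.
split=> [x _|v]; first exact: differentiable_cst.
rewrite (_ : (fun _ => _) = (fun _ : E => 0)); first exact: IH.
by apply/funext => x; rewrite (diff_cst a).
Qed.

Lemma smooth_diff (f : E -> W) v :
  smooth setT f -> smooth setT (fun x => 'd f x v).
Proof. by move=> fs k; have /CkSP[_] := fs k.+1; apply. Qed.

Lemma smooth_differentiable (f : E -> W) x : smooth setT f -> differentiable f x.
Proof. by move=> /(_ 1%N)/CkSP[]. Qed.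

Lemma smooth_continuous (f : E -> W) : smooth setT f -> continuous f.
Proof. by move=> /(_ 0%N) fc x; exact: fc. Qed.

Lemma Ck_linear k (l : {linear E -> W}) : continuous l -> Ck k setT l.
Proof.
move=> lc; case: k => [|k]; first by move=> x _; exact: lc.
apply/CkSP; split=> [x|v]; first exact: linear_differentiable.
rewrite (_ : (fun _ => _) = (fun _ : E => l v)); first exact: Ck_cst.
by apply/funext => x; rewrite diff_lin.
Qed.

End SmoothBasics.

Section SmoothCalculus.
Context {R : realType} {E : normedModType R}.
Implicit Types (f g : E -> R^o) (k : nat).

Lemma diffDE f g x v : differentiable f x -> differentiable g x ->
  'd (fun z => f z + g z) x v = 'd f x v + 'd g x v.
Proof. by move=> df dg; rewrite (diffD df dg). Qed.

Lemma diffME f g x v : differentiable f x -> differentiable g x ->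
  'd (fun z => f z * g z) x v = f x * 'd g x v + g x * 'd f x v.
Proof. by move=> df dg; rewrite (diffM df dg). Qed.

Lemma diff_compE (h : R^o -> R^o) f x v :
  differentiable f x -> differentiable h (f x) ->
  'd (h \o f) x v = 'd f x v * 'd h (f x) 1.
Proof.
move=> df dh; rewrite (diff_comp df dh) /=.
by rewrite -[in LHS](mulr1 ('d f x v)) -[_ * 1]/(_ *: (1 : R^o)) linearZ.
Qed.

Lemma CkD k f g : Ck k setT f -> Ck k setT g -> Ck k setT (fun x => f x + g x).
Proof.
elim: k f g => [|k IH] f g.
  by move=> fc gc x _; apply: continuousD; [exact: fc|exact: gc].
move=> /CkSP[df ddf] /CkSP[dg ddg]; apply/CkSP; split=> [x|v].
  exact: differentiableD.
rewrite (_ : (fun _ => _) = (fun x => 'd f x v + 'd g x v)); first exact: IH.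
by apply/funext => x; rewrite diffDE.
Qed.

Lemma CkM k f g : Ck k setT f -> Ck k setT g -> Ck k setT (fun x => f x * g x).
Proof.
elim: k f g => [|k IH] f g.
  by move=> fc gc x _; apply: continuousM; [exact: fc|exact: gc].
move=> fk gk; have /CkSP[df ddf] := fk; have /CkSP[dg ddg] := gk.
apply/CkSP; split=> [x|v]; first exact: differentiableM.
rewrite (_ : (fun _ => _) = (fun x => f x * 'd g x v + g x * 'd f x v)).
  by apply: CkD; apply: IH; [exact: CkS| |exact: CkS|].
by apply/funext => x; rewrite diffME.
Qed.

Lemma Ck_comp k (h : R^o -> R^o) f :
  Ck k setT h -> Ck k setT f -> Ck k setT (h \o f).
Proof.
elim: k h f => [|k IH] h f.
  by move=> hc fc x _; apply: continuous_comp; [exact: fc|exact: hc].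
move=> /CkSP[dh ddh] fk; have /CkSP[df ddf] := fk.
apply/CkSP; split=> [x|v]; first exact: differentiable_comp.
rewrite (_ : (fun _ => _) = (fun x => 'd f x v * ((fun s => 'd h s 1) \o f) x)).
  by apply: CkM; [|apply: IH; [|exact: CkS]].
by apply/funext => x; rewrite diff_compE.
Qed.

Lemma Ck_inv k f : (forall x, f x != 0) -> Ck k setT f ->
  Ck k setT (fun x => (f x)^-1).
Proof.
move=> f0; elim: k => [|k IH].
  by move=> fc x _; apply: continuousV => //; exact: fc.
move=> fk; have /CkSP[df ddf] := fk.
apply/CkSP; split=> [x|v]; first exact: differentiableV.
rewrite (_ : (fun _ => _) =
    (fun x => -1 * ((f x)^-1 * ((f x)^-1 * 'd f x v)))).
  have fV := IH (CkS fk).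
  by apply: CkM; [exact: Ck_cst|apply: CkM => //; exact: CkM].
apply/funext => x; rewrite (diffV (df _) (f0 _)) /= mulN1r mulrA -expr2.
by rewrite exprVn scaleNr.
Qed.

Lemma Ck_sum k (J : Type) (r : seq J) (P : pred J) (F : J -> E -> R^o) :
  (forall j, Ck k setT (F j)) -> Ck k setT (fun x => \sum_(j <- r | P j) F j x).
Proof.
move=> Fk; elim: r => [|j r IH].
  by under eq_fun do rewrite big_nil; exact: Ck_cst.
under eq_fun do rewrite big_cons.
by case: (P j) => //; exact: CkD.
Qed.

Lemma Ck_prod k (J : Type) (r : seq J) (P : pred J) (F : J -> E -> R^o) :
  (forall j, Ck k setT (F j)) -> Ck k setT (fun x => \prod_(j <- r | P j) F j x).
Proof.
move=> Fk; elim: r => [|j r IH].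
  by under eq_fun do rewrite big_nil; exact: Ck_cst.
under eq_fun do rewrite big_cons.
by case: (P j) => //; exact: CkM.
Qed.

Lemma diff_sum (J : Type) (r : seq J) (P : pred J) (F : J -> E -> R^o) x v :
  (forall j, differentiable (F j) x) ->
  differentiable (fun z => \sum_(j <- r | P j) F j z) x /\
  'd (fun z => \sum_(j <- r | P j) F j z : R^o) x v =
    \sum_(j <- r | P j) 'd (F j) x v.
Proof.
move=> Fd; elim: r => [|j r [IHd IH]].
  under eq_fun do rewrite big_nil.
  rewrite big_nil; split; first exact: differentiable_cst.
  by rewrite (diff_cst (0 : R^o)).
under eq_fun do rewrite big_cons.
rewrite big_cons -IH; case: (P j) => //.
split; first exact: differentiableD.
by rewrite diffDE.
Qed.

Lemma diff_derive (f : E -> R^o) x v (s : R^o) : differentiable f (x + s *: v) ->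
  is_derive s 1 (fun t : R^o => f (x + t *: v)) ('d f (x + s *: v) v).
Proof.
move=> fd.
have ld : is_diff (s : R^o) (fun t : R^o => x + t *: v) ( *:%R^~ v).
  apply: is_diff_eq; exact: add0r.
have -> : (fun t : R^o => f (x + t *: v)) = f \o (fun t : R^o => x + t *: v) by [].
have dc : differentiable (f \o (fun t : R^o => x + t *: v)) s.
  by apply: differentiable_comp => //; exact: ex_diff.
apply: DeriveDef; first exact: diff_derivable.
by rewrite deriveE// diff_comp//= (@diff_val _ _ _ _ _ _ _ ld) scale1r.
Qed.

(** Fermat's rule, applied along the line through [x] in the direction [v]. *)
Lemma diff_at_min (f : E -> R^o) x v : (forall z, differentiable f z) ->
  (forall z, f x <= f z) -> 'd f x v = 0.
Proof.
move=> fd fmin.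
have gd := diff_derive (fd (x + (0 : R^o) *: v)).
have g0 : is_derive (0 : R^o) 1 (fun t : R^o => f (x + t *: v)) 0.
  apply: (@derive1_at_min _ _ (-1) 1); rewrite ?in_itv/= ?ltrN10 ?ltr01//.
    by move=> t _; apply: ex_derive; exact: diff_derive.
  by move=> t _; rewrite scale0r addr0.
have := @derive_val _ _ _ _ _ _ _ gd.
by rewrite (@derive_val _ _ _ _ _ _ _ g0) scale0r addr0 => ->.
Qed.

Lemma diff_at_max (f : E -> R^o) x v : (forall z, differentiable f z) ->
  (forall z, f z <= f x) -> 'd f x v = 0.
Proof.
move=> fd fmax; have : 'd (- f) x v = 0.
  by apply: diff_at_min => z; [exact: differentiableN|rewrite lerN2].
by rewrite (diffN (fd x)) => /eqP; rewrite oppr_eq0 => /eqP.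
Qed.

End SmoothCalculus.

(** * A smooth step function *)

Section SmoothStep.
Context {R : realType}.

Lemma Ck_derive1 k (f f' : R -> R) :
  (forall x : R, is_derive x 1 f (f' x)) ->
  Ck k setT (f' : R^o -> R^o) -> Ck k.+1 setT (f : R^o -> R^o).
Proof.
move=> df f'k.
have df1 (x : R) : derivable f x 1 by have [] := df x.
apply/CkSP; split=> [x|v]; first exact/derivable1_diffP.
rewrite (_ : (fun _ => _) = (fun x => v * f' x)).
  by apply: CkM => //; exact: Ck_cst.
apply/funext => x; rewrite deriv1E//= derive1E.
by rewrite (@derive_val _ _ _ _ _ _ _ (df x)).
Qed.

Lemma smooth_affine (a b : R) : smooth setT (fun s : R^o => a * s + b : R^o).
Proof.
move=> k; apply: CkD; last exact: Ck_cst.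
apply: CkM; first exact: Ck_cst.
by apply: (@Ck_linear _ _ _ _ idfun) => s; exact: cvg_id.
Qed.

(** The derivatives of the flat function [flat 0] are combinations of the
    [flat n]; working with the whole family closes inductions on the order of
    differentiation. *)
Definition flat (n : nat) (x : R) : R :=
  if 0 < x then x^-1 ^+ n * expR (- x^-1) else 0.

Lemma flat_ge0 n x : 0 <= flat n x.
Proof.
rewrite /flat; case: ifPn => // x0.
by rewrite mulr_ge0 ?expR_ge0// exprn_ge0// invr_ge0 ltW.
Qed.

Lemma flat0 n x : x <= 0 -> flat n x = 0.
Proof. by rewrite /flat ltNge => ->. Qed.

Lemma flat_gt0 n x : 0 < x -> 0 < flat n x.
Proof.
by move=> x0; rewrite /flat x0 mulr_gt0 ?expR_gt0// exprn_gt0// invr_gt0.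
Qed.

Lemma flat_bound n x : flat n x <= n.+1`!%:R * `|x|.
Proof.
rewrite /flat; case: ifPn => x0; last by rewrite mulr_ge0.
have xV0 : 0 < x^-1 by rewrite invr_gt0.
rewrite expRN ler_pdivrMr ?expR_gt0// gtr0_norm//.
have h := expR_ge1Dxn n (ltW xV0).
apply: (@le_trans _ _ (n.+1`!%:R * x * (x^-1 ^+ n.+1 / n.+1`!%:R))).
  have f0 : n.+1`!%:R != 0 :> R by rewrite pnatr_eq0 -lt0n fact_gt0.
  rewrite exprS; set a := x^-1 ^+ n; rewrite le_eqVlt; apply/orP; left.
  by apply/eqP; field; rewrite f0 gt_eqF.
rewrite ler_wpM2l ?mulr_ge0 ?(ltW x0)//.
by apply: le_trans h; rewrite lerDr.
Qed.

(** Continuity of [flat n.+1] at [0] is differentiability of [flat n] there. *)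
Lemma flat_mul n x : flat n x = flat n.+1 x * x.
Proof.
rewrite /flat; case: ifPn => x0; last by rewrite mul0r.
by rewrite exprS [RHS]mulrC !mulrA mulfV ?gt_eqF// mul1r.
Qed.

Lemma flat_cvg0 n : {for (0 : R), continuous (flat n)}.
Proof.
apply/(@cvgrPdist_le _ _ _ (nbhs (0 : R))) => e e0.
rewrite [flat n 0]flat0//.
near=> x; rewrite sub0r normrN ger0_norm ?flat_ge0//.
rewrite (le_trans (flat_bound _ _))// mulrC -ler_pdivlMr ?ltr0n ?fact_gt0//.
near: x; apply/nbhs_normP; exists (e / n.+1`!%:R) => /=.
  by rewrite divr_gt0// ltr0n fact_gt0.
by move=> y /=; rewrite sub0r normrN => /ltW.
Unshelve. all: by end_near. Qed.

Lemma is_derive_flat n (x : R) :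
  is_derive x 1 (flat n) (flat n.+2 x - n%:R * flat n.+1 x).
Proof.
have [x0|x0|->] := ltgtP x 0.
- rewrite !flat0 ?(ltW x0)// mulr0 subr0.
  apply: (@near_eq_is_derive _ _ _ (cst 0)).
  near=> y; rewrite flat0//; apply/ltW; near: y.
  exact: lt_nbhsl.
- have xN0 : x != 0 by rewrite gt_eqF.
  have dV : is_derive x 1 (fun y : R => y^-1) (- x ^- 2).
    apply: is_derive_eq; first exact: (is_deriveV (f := id)).
    by rewrite -[_ *: _]/(_ * _) mulr1.
  have dX := is_deriveX n dV.
  have dE : is_derive x 1 (expR \o (fun y : R => - y^-1)) (expR (- x^-1) * x ^- 2).
    apply: is_derive1_comp; rewrite -[x ^- 2]opprK; exact: is_deriveN.
  apply: near_eq_is_derive (is_derive_eq (is_deriveM dX dE) _).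
    near=> y; rewrite /flat ifT ?exprfctE//; near: y; exact: lt_nbhsr.
  rewrite /flat x0 /= -![_ *: _]/(_ * _) !exprS !exprfctE.
  have -> : n%:R * x^-1 ^+ n.-1 = n%:R * x^-1 ^+ n * x.
    case: (n) => [|j]; first by rewrite !mul0r.
    by rewrite -mulrA exprSr divfK.
  by rewrite expr0; set a := x^-1 ^+ n; set e := expR _; field.
- rewrite !flat0// mulr0 subr0.
  apply/is_derive1_caratheodory; exists (flat n.+1); split.
  + by move=> z; rewrite [flat n 0]flat0// !subr0 flat_mul.
  + exact: flat_cvg0.
  + by rewrite flat0.
Unshelve. all: by end_near. Qed.

Lemma Ck_flat k n : Ck k setT (flat n : R^o -> R^o).
Proof.
elim: k n => [|k IH] n.
  move=> x _; apply: differentiable_continuous; apply/derivable1_diffP.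
  by have [] := is_derive_flat n x.
apply: Ck_derive1; first exact: is_derive_flat.
rewrite (_ : (fun _ => _) = (fun x => flat n.+2 x + - n%:R * flat n.+1 x)).
  by apply: CkD => //; apply: CkM => //; exact: Ck_cst.
by apply/funext => x; rewrite mulNr.
Qed.

Definition step (s : R) : R := flat 0 s * (flat 0 s + flat 0 (1 - s))^-1.

Let step_den s : 0 < flat 0 s + flat 0 (1 - s).
Proof.
have [s0|s0] := leP s 0; last by rewrite ltr_pwDl ?flat_gt0 ?flat_ge0.
by rewrite ltr_wpDl ?flat_ge0// flat_gt0// subr_gt0 (le_lt_trans s0).
Qed.

Lemma smooth_step : smooth setT (step : R^o -> R^o).
Proof.
move=> k; apply: CkM; first exact: Ck_flat.
apply: Ck_inv => [s|]; first by rewrite gt_eqF.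
apply: CkD; first exact: Ck_flat.
apply: (@Ck_comp _ _ _ (flat 0) (fun s : R^o => 1 - s)); first exact: Ck_flat.
rewrite (_ : (fun _ => _) = (fun s : R^o => -1 * s + 1 : R^o)); last first.
  by apply/funext => s; rewrite mulN1r addrC.
exact: smooth_affine.
Qed.

Lemma smooth_step_affine (a b : R) :
  smooth setT (fun s : R^o => step (a * s + b) : R^o).
Proof.
move=> k; apply: (@Ck_comp _ _ _ step (fun s : R^o => a * s + b : R^o)).
  exact: smooth_step.
exact: smooth_affine.
Qed.

Lemma step_le0 s : s <= 0 -> step s = 0.
Proof. by move=> s0; rewrite /step [flat 0 s]flat0// mul0r. Qed.

Lemma step_ge1 s : 1 <= s -> step s = 1.
Proof.
move=> s1; have := step_den s; rewrite /step [flat 0 (1 - s)]flat0 ?subr_le0//.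
by rewrite addr0 => d0; rewrite mulfV// gt_eqF.
Qed.

Lemma step_ge0 s : 0 <= step s.
Proof. by rewrite /step mulr_ge0 ?flat_ge0// invr_ge0 ltW. Qed.

Lemma step_le1 s : step s <= 1.
Proof. by rewrite /step ler_pdivrMr// mul1r lerDl flat_ge0. Qed.

End SmoothStep.

(** * Global solutions of bounded Lipschitz differential equations *)

Section Picard.
Context {R : realType}.

Let mu := @lebesgue_measure R.

(** Starting the integral at [-1] makes the derivative at [0] two-sided. *)
Let prim (g : R -> R) (t : R) : R :=
  \int[mu]_(s in `[-1, t]) g s - \int[mu]_(s in `[-1, 0]) g s.

Let prim0 g : prim g 0 = 0. Proof. exact: subrr. Qed.

Let is_derive_prim (g : R -> R) (t : R) : continuous g -> 0 <= t ->
  is_derive t 1 (prim g) (g t).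
Proof.
move=> gc t0.
have gi : mu.-integrable `[-1, (t + 1)] (EFin \o g).
  apply: continuous_compact_integrable; first exact: segment_compact.
  exact: continuous_subspaceT.
have tt1 : t < t + 1 by rewrite ltrDl.
have t1 : -1 < t by rewrite (lt_le_trans _ t0)// ltrN10.
have [dF FE] := continuous_FTC1_closed tt1 gi t1 (gc t).
have dg : is_derive t 1 (fun t => \int[mu]_(s in `[-1, t]) g s) (g t).
  by apply: DeriveDef; [exact: dF|rewrite -derive1E; exact: FE].
rewrite -[g t]subr0; exact: (is_deriveB dg (is_derive_cst _ _ _)).
Qed.

Lemma lip_continuous (g : R -> R) (C : R) :
  (forall s t, `|g t - g s| <= C * `|t - s|) -> continuous g.
Proof.
move=> gC x; apply/(@cvgrPdist_le _ _ _ (nbhs x)) => e e0.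
have C0 : 0 <= C.
  have := gC 0 1; rewrite subr0 normr1 mulr1; exact: le_trans.
have C1 : 0 < C + 1 by rewrite ltr_wpDl.
near=> y; rewrite (le_trans (gC _ _))//.
have : `|x - y| <= e / (C + 1).
  by near: y; apply/nbhs_normP; exists (e / (C + 1));
    [exact: divr_gt0|move=> y /= /ltW].
rewrite ler_pdivlMr// mulrC; apply: le_trans.
by rewrite ler_wpM2r// lerDl.
Unshelve. all: by end_near. Qed.

Let MVT_ge0 (g g' : R -> R) (s t : R) :
  (forall t : R, 0 <= t -> is_derive t 1 g (g' t)) -> 0 <= s -> s <= t ->
  exists2 c, 0 <= c & g t - g s = g' c * (t - s).
Proof.
move=> dg s0 st.
have dgs x : x \in `]s, t[ -> is_derive x 1 g (g' x).
  by rewrite in_itv/= => /andP[/ltW sx _]; apply: dg; exact: le_trans sx.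
have gc : {within `[s, t], continuous g}.
  apply: derivable_within_continuous => x; rewrite in_itv/= => /andP[sx _].
  by have [] := dg x (le_trans s0 sx).
have [c] := MVT_segment st dgs gc.
rewrite in_itv/= => /andP[sc _] e; exists c => //; exact: le_trans sc.
Qed.

(** The right-hand side of the bound on [g'] is the derivative of
    [B * expR (lam * t)], so the difference with [g] is monotone. *)
Let exp_bound (g g' : R -> R) (B lam t : R) : 0 <= B ->
  (forall t : R, 0 <= t -> is_derive t 1 g (g' t)) -> g 0 = 0 ->
  (forall t, 0 <= t -> `|g' t| <= lam * B * expR (lam * t)) ->
  0 <= t -> `|g t| <= B * expR (lam * t).
Proof.
move=> B0 dg g0 g'b t0.
have dE (s : R) : is_derive s 1 (fun t => B * expR (lam * t))
    (lam * B * expR (lam * s)).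
  have dl : is_derive s 1 (fun t : R => lam * t) lam.
    have := is_deriveZ lam (is_derive_id s (1 : R)).
    by rewrite -[lam *: 1]/(lam * 1) mulr1.
  have := is_deriveZ B (is_derive1_comp (is_derive_expR (lam * s)) dl).
  by rewrite -[B *: _]/(B * _) [expR _ * lam]mulrC mulrA [B * lam]mulrC.
have mono (h h' : R -> R) : (forall s : R, 0 <= s -> is_derive s 1 h (h' s)) ->
    h 0 = 0 -> (forall s, 0 <= s -> h' s <= lam * B * expR (lam * s)) ->
    h t <= B * expR (lam * t).
  move=> dh h0 h'b.
  have dD (s : R) : 0 <= s -> is_derive s 1 (fun t => B * expR (lam * t) - h t)
      (lam * B * expR (lam * s) - h' s).
    by move=> s0; exact: (is_deriveB (dE s) (dh s s0)).
  have [c c0] := MVT_ge0 dD (lexx 0) t0.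
  rewrite /= h0 !(mulr0, subr0) expR0 mulr1 => e.
  have : 0 <= (lam * B * expR (lam * c) - h' c) * t.
    by rewrite mulr_ge0// subr_ge0 h'b.
  rewrite -e; lra.
rewrite ler_norml; apply/andP; split.
  rewrite lerNl; apply: (mono (fun t => - g t) (fun t => - g' t)).
  - by move=> s s0; exact: (is_deriveN (dg s s0)).
  - by rewrite g0 oppr0.
  - by move=> s s0; rewrite (le_trans (ler_norm _))// normrN g'b.
apply: (mono g g') => // s s0; exact: (le_trans (ler_norm _) (g'b s s0)).
Qed.

Let lip_bound (g g' : R -> R) (M : R) s t :
  (forall t : R, 0 <= t -> is_derive t 1 g (g' t)) ->
  (forall t, 0 <= t -> `|g' t| <= M) ->
  0 <= s -> 0 <= t -> `|g t - g s| <= M * `|t - s|.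
Proof.
move=> dg g'M.
wlog st : s t / s <= t.
  move=> H s0 t0; have [st|/ltW ts] := leP s t; first exact: H.
  by rewrite distrC [`|t - s|]distrC; exact: H.
move=> s0 t0.
have [c c0 ->] := MVT_ge0 dg s0 st.
by rewrite normrM ler_wpM2r// g'M.
Qed.

(** The intervals of radius [C * 2 / 2 ^+ n] around [a n] are nested. *)
Let geometric_cvg (a : nat -> R) (C : R) :
  (forall n, `|a n.+1 - a n| <= C / 2 ^+ n) ->
  exists l, forall n, `|l - a n| <= C * 2 / 2 ^+ n.
Proof.
move=> aC; pose r n := C * 2 / 2 ^+ n.
have C0 : 0 <= C by have := aC 0%N; rewrite expr0 divr1; exact: le_trans.
have r0 n : 0 <= r n by rewrite /r !mulr_ge0// invr_ge0 exprn_ge0.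
have rS n : r n = r n.+1 + C / 2 ^+ n.
  by rewrite /r exprS; field; rewrite expf_neq0.
have incr m n : (m <= n)%N -> a m - r m <= a n - r n /\ a n + r n <= a m + r m.
  elim: n => [|n IH]; first by rewrite leqn0 => /eqP ->.
  rewrite leq_eqVlt => /orP[/eqP ->//|/IH[h1 h2]].
  have := aC n; rewrite ler_norml => /andP[h3 h4].
  have := rS n; split; lra.
have cross m n : a m - r m <= a n + r n.
  have [h1 _] := incr _ _ (leq_maxl m n).
  have [_ h2] := incr _ _ (leq_maxr m n).
  have := r0 (maxn m n); lra.
have ub n : ubound (range (fun n => a n - r n)) (a n + r n).
  by move=> _ [m _ <-]; exact: cross.
have ne : range (fun n => a n - r n) !=set0 by exists (a 0%N - r 0%N), 0%N.
exists (sup (range (fun n => a n - r n))) => n.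
have h1 : a n - r n <= sup (range (fun n => a n - r n)).
  by apply: ub_le_sup; [exists (a 0%N + r 0%N); exact: ub|exists n].
have h2 : sup (range (fun n => a n - r n)) <= a n + r n by apply: ge_sup.
by rewrite ler_norml -/(r n); apply/andP; split; lra.
Qed.

Let geometric_le0 (x C : R) : (forall n, x <= C / 2 ^+ n) -> x <= 0.
Proof.
move=> xC; rewrite leNgt; apply/negP => x0.
have C0 : 0 < C by have := lt_le_trans x0 (xC 0%N); rewrite expr0 divr1.
pose n := Num.bound (C / x).
have := xC n; rewrite ler_pdivlMr ?exprn_gt0// => h.
have h1 : C / x < 2 ^+ n.
  apply: (@lt_le_trans _ _ n%:R).
    by rewrite /n archi_boundP// divr_ge0 ?ltW.
  by rewrite -natrX ler_nat ltnW// ltn_expl.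
by move: h1; rewrite ltr_pdivrMr// mulrC ltNge h.
Qed.

(** Existence half of the Picard-Lindelof theorem. The Picard iterates [v n]
    approach each other by a factor 2 at each step in the supremum norm weighted
    by [expR (- lam * t)], which gives a solution for all nonnegative times at
    once. The vector field is evaluated along curves frozen at negative times
    ([clamp]), so that integrands are continuous on the whole line. *)
Lemma picard (I : finType) (f : (I -> R) -> I -> R) (L M : R) (z : I -> R) :
  (forall u v i, `|f u i - f v i| <= L * \sum_j `|u j - v j|) ->
  (forall u i, `|f u i| <= M) ->
  exists u : R -> I -> R, u 0 = z /\
    forall (t : R) i, 0 <= t -> is_derive t 1 (u ^~ i) (f (u t) i).
Proof.
have [i0|I0] := pselect (exists i : I, True); last first.
  move=> _ _; exists (fun _ => z); split=> // t i; exfalso; apply: I0.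
  by exists i.
move: i0 => [i0 _] fL fM.
have M0 : 0 <= M by exact: le_trans (normr_ge0 _) (fM z i0).
have L0 : 0 <= L.
  rewrite leNgt; apply/negP => L0.
  have := fL (fun=> 1) (fun=> 0) i0; rewrite leNgt => /negP; apply.
  apply: (lt_le_trans _ (normr_ge0 _)); rewrite pmulr_llt0//.
  rewrite (bigD1 i0)//= subr0 normr1 ltr_wpDr//.
  exact: sumr_ge0.
pose m : R := #|I|%:R.
have m0 : 0 <= m by exact: ler0n.
pose lam := 2 * L * m + 1.
have lam1 : 1 <= lam by rewrite /lam lerDr !mulr_ge0.
have lam0 : 0 <= lam by exact: le_trans lam1.
have Mn0 n : 0 <= M / 2 ^+ n by rewrite divr_ge0// exprn_ge0.
have Mne0 n t : 0 <= M / 2 ^+ n * expR (lam * t).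
  by rewrite mulr_ge0 ?expR_ge0.
have sum_le (F : I -> R) K : (forall i, F i <= K) -> \sum_i F i <= m * K.
  move=> FK; apply: (@le_trans _ _ (\sum_(i : I) K)); first exact: ler_sum.
  by rewrite sumr_const -[leLHS]mulr_natl.
pose clamp (t : R) := Num.max t 0.
have clamp0 t : 0 <= clamp t by rewrite /clamp le_max lexx orbT.
have clampE t : 0 <= t -> clamp t = t by move=> t0; rewrite /clamp max_l.
have clamp_lip s t : `|clamp t - clamp s| <= `|t - s|.
  rewrite /clamp /Num.max; case: ltP => [t0|t0]; case: ltP => [s0|s0] //.
  - by rewrite subrr normr0.
  - rewrite sub0r normrN ger0_norm// ler0_norm; lra.
  - rewrite subr0 ger0_norm// ger0_norm; lra.
pose field_along (w : R -> I -> R) i (s : R) := f (w (clamp s)) i.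
have field_along_cont w i :
    (forall s t i, 0 <= s -> 0 <= t -> `|w t i - w s i| <= M * `|t - s|) ->
    continuous (field_along w i).
  move=> wM; apply: (@lip_continuous _ (L * (m * M))) => s t.
  rewrite (le_trans (fL _ _ _))// -!mulrA ler_wpM2l// sum_le// => j.
  by rewrite (le_trans (wM _ _ _ _ _))// ler_wpM2l.
pose v := fix v n : R -> I -> R := if n is n'.+1 then
  fun t i => z i + prim (field_along (v n') i) t else fun _ => z.
have dprim w i (t : R) : 0 <= t -> continuous (field_along w i) ->
    is_derive t 1 (fun t => z i + prim (field_along w i) t) (f (w t) i).
  move=> t0 wc; rewrite -[f _ _]add0r -{2}(clampE _ t0).
  exact: (is_deriveD (is_derive_cst _ _ _) (is_derive_prim wc t0)).
have vM n s t i : 0 <= s -> 0 <= t -> `|v n t i - v n s i| <= M * `|t - s|.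
  elim: n s t i => [|n IH] s t i s0 t0.
    by rewrite /= subrr normr0 mulr_ge0.
  apply: (@lip_bound ((v n.+1)^~ i) (fun t => f (v n t) i)) => // r r0.
  by apply: dprim => //; exact: field_along_cont.
have dv n i (t : R) : 0 <= t -> is_derive t 1 ((v n.+1)^~ i) (f (v n t) i).
  by move=> t0; apply: dprim => //; apply: field_along_cont; exact: vM.
have v0 n i : v n 0 i = z i by case: n => //= n; rewrite prim0 addr0.
have vz t : v 0%N t = z by [].
clearbody v.
(* the choice of [lam] turns the Lipschitz constant into a factor [1 / 2] *)
have contract n t i : 0 <= t ->
    `|v n.+1 t i - v n t i| <= M / 2 ^+ n * expR (lam * t).
  elim: n t i => [|n IH] t i t0.
    rewrite vz; apply: (@exp_bound (fun t => v 1%N t i - z i) (fun t => f z i) _ _ _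
      (Mn0 0%N)) => //.
    - move=> s s0; rewrite -[f z i]subr0.
      by have := is_deriveB (dv 0%N i s s0) (is_derive_cst (z i) _ _); rewrite vz.
    - by rewrite !v0 subrr.
    - move=> s s0; rewrite (le_trans (fM _ _))// expr0 divr1 mulrAC ler_peMl//.
      rewrite mulr_ege1//; apply: le_trans (expR_ge1Dx _).
      by rewrite lerDl mulr_ge0.
  apply: (@exp_bound (fun t => v n.+2 t i - v n.+1 t i)
    (fun t => f (v n.+1 t) i - f (v n t) i) _ _ _ (Mn0 n.+1)) => //.
  - by move=> s s0; exact: (is_deriveB (dv n.+1 i s s0) (dv n i s s0)).
  - by rewrite !v0 subrr.
  move=> s s0; rewrite (le_trans (fL _ _ _))//.
  set X := M / 2 ^+ n * expR (lam * s).
  have X0 : 0 <= X by exact: Mne0.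
  apply: (@le_trans _ _ (L * (m * X))).
    by rewrite ler_wpM2l// sum_le// => j; exact: IH.
  have -> : lam * (M / 2 ^+ n.+1) * expR (lam * s) = lam / 2 * X.
    by rewrite /X exprS; field; rewrite expf_neq0.
  rewrite mulrA ler_wpM2r// /lam; lra.
have {}/choice[u uE] : forall ti : R * I, exists l : R, 0 <= ti.1 ->
    forall n, `|l - v n ti.1 ti.2| <= M * expR (lam * ti.1) * 2 / 2 ^+ n.
  move=> [t i]; have [t0|t0] := leP 0 t; last first.
    by exists 0.
  have vc n : `|v n.+1 t i - v n t i| <= M * expR (lam * t) / 2 ^+ n.
    by rewrite (le_trans (contract _ _ _ t0))// mulrAC.
  by have [l lE] := geometric_cvg vc; exists l => _; exact: lE.
pose w t i := u (t, i).
have wM s t i : 0 <= s -> 0 <= t -> `|w t i - w s i| <= M * `|t - s|.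
  move=> s0 t0; rewrite -subr_le0.
  apply: (geometric_le0 (C := M * expR (lam * t) * 2 + M * expR (lam * s) * 2)).
  move=> n; have h1 := uE (t, i) t0 n; have h2 := uE (s, i) s0 n.
  have h3 := vM n s t i s0 t0; rewrite mulrDl.
  move: h1 h2 h3; rewrite -/(w t i) -/(w s i) /= !ler_norml.
  move=> /andP[a1 a2] /andP[b1 b2] /andP[c1 c2].
  rewrite lerBlDr ler_norml; apply/andP; split; lra.
have wc i : continuous (field_along w i) by apply: field_along_cont; exact: wM.
pose y t i := z i + prim (field_along w i) t.
have dy i (t : R) : 0 <= t -> is_derive t 1 (y ^~ i) (f (w t) i).
  by move=> t0; exact: dprim.
have y0 i : y 0 i = z i by rewrite /y prim0 addr0.
clearbody y.
(* the iterates converge to both [w] and [y], so [w] solves the equation *)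
have yw t : 0 <= t -> y t = w t.
  move=> t0; apply/funext => i; apply/eqP; rewrite -subr_eq0 -normr_le0.
  apply: (geometric_le0 (C := M * expR (lam * t) * 2)) => n.
  have h1 := uE (t, i) t0 n.+1.
  have h2 : `|y t i - v n.+1 t i| <= M / 2 ^+ n * expR (lam * t).
    apply: (@exp_bound (fun t => y t i - v n.+1 t i)
      (fun t => f (w t) i - f (v n t) i) _ _ _ (Mn0 n) _ _ _ t0).
    - by move=> s s0; exact: (is_deriveB (dy i s s0) (dv n i s s0)).
    - by rewrite v0 y0 subrr.
    move=> s s0; rewrite (le_trans (fL _ _ _))//.
    set X := M / 2 ^+ n * expR (lam * s).
    have X0 : 0 <= X by exact: Mne0.
    apply: (@le_trans _ _ (L * (m * (2 * X)))).
      rewrite ler_wpM2l// sum_le// => j.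
      rewrite (le_trans (uE (s, j) s0 n))// /X.
      rewrite /= le_eqVlt; apply/orP; left; apply/eqP; ring.
    rewrite -[leRHS]mulrA -/X (_ : L * (m * (2 * X)) = 2 * L * m * X); last by ring.
    rewrite ler_wpM2r// /lam; lra.
  have -> : M * expR (lam * t) * 2 / 2 ^+ n = M / 2 ^+ n * expR (lam * t)
      + M * expR (lam * t) * 2 / 2 ^+ n.+1.
    by rewrite exprS; field; rewrite expf_neq0.
  rewrite (_ : y t i - w t i = (y t i - v n.+1 t i) - (w t i - v n.+1 t i));
    last by ring.
  by rewrite (le_trans (ler_normB _ _))// lerD.
exists y; split=> [|t i t0].
  exact/funext.
by rewrite yw//; exact: dy.
Qed.

End Picard.

(** * Coordinates on a finite-dimensional normed space *)

Section Coordinates.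
Context {R : realType} {E : finNormedModType R}.

Local Notation n := (\dim {:E}).

Definition basis_vec (i : 'I_n) : E := (vbasis {:E})`_i.
Definition coef (i : 'I_n) : {linear E -> R^o} := coord (vbasis {:E}) i.

Lemma coef_expansion x : x = \sum_i coef i x *: basis_vec i.
Proof. exact: (coord_vbasis (memvf x)). Qed.

Lemma coef_basis_vec i j : coef i (basis_vec j) = (i == j)%:R.
Proof. rewrite (eq_sym i); exact: (coord_free j i (basis_free (vbasisP _))). Qed.

Lemma coef_lincomb (k : 'I_n -> R) i :
  coef i (\sum_j k j *: basis_vec j) = k i.
Proof. exact: coord_sum_free (basis_free (vbasisP _)). Qed.

Lemma fin_linear_continuous (W : normedModType R) (f : {linear E -> W}) :
  continuous f.
Proof.
have [C C0 fC] := linear_bounded f.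
have C1 : 0 < C + 1 by rewrite ltr_wpDl.
move=> x; apply/cvgrPdist_le => e e0; near=> y.
rewrite -linearB (le_trans (fC _))//.
have : `|x - y| <= e / (C + 1).
  by near: y; apply/nbhs_normP; exists (e / (C + 1));
    [exact: divr_gt0|move=> y /= /ltW].
rewrite ler_pdivlMr// mulrC; apply: le_trans.
by rewrite ler_wpM2r// lerDl.
Unshelve. all: by end_near. Qed.

Lemma coef_bound : exists2 C : R, 0 < C & forall i x, `|coef i x| <= C * `|x|.
Proof.
have /choice[C CE] : forall i, exists C, 0 <= C /\ forall x, `|coef i x| <= C * `|x|.
  by move=> i; have [C] := linear_bounded (coef i); exists C.
have CS i : C i <= 1 + \sum_j C j.
  rewrite (bigD1 i)//= addrCA lerDl addr_ge0// sumr_ge0// => j _.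
  by have [] := CE j.
exists (1 + \sum_j C j).
  by rewrite ltr_pwDl// sumr_ge0// => j _; have [] := CE j.
by move=> i x; have [_ /(_ x)/le_trans] := CE i; apply; rewrite ler_wpM2r.
Qed.

Lemma norm_coef_le : exists2 C : R, 0 < C &
  forall x (A : R), (forall i, `|coef i x| <= A) -> 0 <= A -> `|x| <= C * A.
Proof.
exists (1 + \sum_i `|basis_vec i|); first by rewrite ltr_pwDl// sumr_ge0.
move=> x A xA A0; rewrite [x in leLHS]coef_expansion.
rewrite (le_trans (ler_norm_sum _ _ _))//.
rewrite mulrDl mul1r ler_wpDl// mulr_suml ler_sum// => i _.
by rewrite normrZ mulrC ler_wpM2l.
Qed.

Lemma compact_coef_box (A : R) : compact [set x : E | forall i, `|coef i x| <= A].
Proof.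
pose lc (r : 'rV[R]_n) : E := \sum_i r 0 i *: basis_vec i.
have -> : [set x : E | forall i, `|coef i x| <= A] =
    lc @` [set r : 'rV[R]_n | forall i, [set` `[- A, A]] (r 0 i)].
  apply/seteqP; split=> [x xA|_ [r rA <-] i] /=.
    exists (\row_i coef i x); last first.
      by rewrite [RHS]coef_expansion; apply: eq_bigr => i _; rewrite mxE.
    by move=> i /=; rewrite mxE in_itv/= -ler_norml; exact: xA.
  by rewrite /lc coef_lincomb ler_norml; exact: rA.
apply: continuous_compact; last first.
  exact: (rV_compact (fun=> @segment_compact R (- A) A)).
apply: continuous_subspaceT => r.
apply: (@cvg_big _ _ _ _ _ add_continuous _ (nbhs r)) => i _.
apply: cvgZr_tmp; exact: coord_continuous.
Qed.

Lemma smooth_coef (i : 'I_n) : smooth setT (coef i).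
Proof. move=> k; apply: Ck_linear; exact: fin_linear_continuous. Qed.

Lemma diff_coef (f : E -> R^o) x v :
  'd f x v = \sum_i coef i v * 'd f x (basis_vec i).
Proof.
rewrite [v in LHS]coef_expansion linear_sum; apply: eq_bigr => i _.
by rewrite linearZ.
Qed.

(** Through this bound, continuity of the derivatives along the basis gives
    continuity of the differential in the dual norm. *)
Lemma linear_coef_le (p : {linear E -> R^o}) (w : R) :
  (forall i : 'I_n, `|p (basis_vec i)| <= w) ->
  forall v, `|p v| <= w * \sum_i `|coef i v|.
Proof.
move=> pw v; rewrite [v in leLHS](coef_expansion v) linear_sum.
rewrite (le_trans (ler_norm_sum _ _ _))// mulr_sumr ler_sum// => i _.
by rewrite linearZ normrM mulrC ler_wpM2r.
Qed.

Lemma sum_coef_bound : exists2 S : R, 0 < S &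
  forall v : E, \sum_i `|coef i v| <= S * `|v|.
Proof.
have [C C0 CE] := coef_bound.
exists (n%:R * C + 1) => [|v]; first by rewrite ltr_wpDl// mulr_ge0// ltW.
apply: (@le_trans _ _ (\sum_(i : 'I_n) C * `|v|)).
  by apply: ler_sum => i _; exact: CE.
rewrite sumr_const card_ord -[leLHS]mulr_natl mulrA ler_wpM2r//.
by rewrite lerDl.
Qed.

Lemma linfunBE (f g : {linear E -> R^o}) v :
  (linfun f - linfun g : 'Hom(E, R^o)) v = f v - g v.
Proof. by rewrite add_lfunE opp_lfunE !lfunE. Qed.

Lemma linfun_scale (f g : {linear E -> R^o}) (c : R) :
  (forall v, f v = c * g v) -> linfun f = c *: linfun g :> 'Hom(E, R^o).
Proof. by move=> fg; apply/lfunP => v; rewrite scale_lfunE !lfunE fg. Qed.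

Lemma compact_norm_bounded (A : set E) : compact A ->
  exists2 r : R, 0 < r & forall x, A x -> `|x| <= r.
Proof.
move=> cA; have [A0|A0] := pselect (A !=set0); last first.
  by exists 1 => // x Ax; exfalso; apply: A0; exists x.
have [c _ cmax] := compact_EVT_max A0 cA
  (continuous_subspaceT (@norm_continuous R E)).
exists (`|c| + 1) => [|x Ax]; first by rewrite ltr_wpDl.
by rewrite (le_trans (cmax x _)) ?inE// lerDl.
Qed.

Lemma convex_segment (K : set E) (x y : E) (t : R) : convex_set K ->
  K x -> K y -> 0 <= t <= 1 -> K (x + t *: (y - x)).
Proof.
move=> convK Kx Ky /andP[t0 t1].
have -> : x + t *: (y - x) = t *: y + (1 - t) *: x.
  by rewrite scalerBl scale1r scalerBr addrCA.
have := convK y x (Itv01 t0 t1); rewrite !inE; exact.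
Qed.

Lemma continuous_compact_supp_bounded (f : E -> R^o) (C : set E) :
  continuous f -> compact C -> (forall x, ~ C x -> f x = 0) ->
  exists2 M : R, 0 <= M & forall x, `|f x| <= M.
Proof.
move=> fc Cc f0.
have [C0|C0] := pselect (C !=set0); last first.
  by exists 0 => // x; rewrite f0 ?normr0// => Cx; apply: C0; exists x.
have nc : continuous (fun x => `|f x|).
  by move=> x; apply: continuous_comp; [exact: fc|exact: norm_continuous].
have [c _ cmax] := compact_EVT_max C0 Cc (continuous_subspaceT nc).
exists `|f c| => // x; have [Cx|/f0 ->] := pselect (C x).
  by apply: cmax; rewrite inE.
by rewrite normr0.
Qed.

Lemma diff_compact_supp (f : E -> R^o) (C : set E) x v : smooth setT f ->
  compact C -> (forall x, ~ C x -> f x = 0) -> ~ C x -> 'd f x v = 0.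
Proof.
move=> fs Cc f0 Cx; rewrite -deriveE; last exact: smooth_differentiable.
rewrite (@near_eq_derive _ _ _ _ (cst 0)); first exact: derive_cst.
have oC : open (~` C).
  by apply: closed_openC; apply: compact_closed => //; exact: norm_hausdorff.
have : nbhs x (~` C) by apply: open_nbhs_nbhs.
by apply: filterS => y /f0.
Qed.

Lemma smooth_compact_supp_lip (f : E -> R^o) (C : set E) : smooth setT f ->
  compact C -> (forall x, ~ C x -> f x = 0) ->
  exists2 L : R, 0 <= L & forall x y,
    `|f x - f y| <= L * `|x - y|.
Proof.
move=> fs Cc f0; have [S S0 SE] := sum_coef_bound.
have /choice[M ME] : forall i, exists M, 0 <= M /\
    forall x, `|'d f x (basis_vec i)| <= M.
  move=> i; have [M M0 MB] := continuous_compact_supp_bounded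
    (smooth_continuous (smooth_diff (basis_vec i) fs)) Cc
    (fun x => diff_compact_supp (basis_vec i) fs Cc f0 (x := x)).
  by exists M.
have M0 : 0 <= \sum_i M i by apply: sumr_ge0 => i _; have [] := ME i.
exists ((\sum_i M i) * S) => [|x y]; first by rewrite mulr_ge0// ltW.
have df (s : R) : is_derive s 1 (fun t : R => f (y + t *: (x - y)))
    ('d f (y + s *: (x - y)) (x - y)).
  by apply: diff_derive; exact: smooth_differentiable.
have fc : {within `[0, 1], continuous (fun t : R => f (y + t *: (x - y)))}.
  by apply: derivable_within_continuous => s _; have [] := df s.
have [c _] := MVT_segment ler01 (fun s _ => df s) fc.
rewrite scale1r scale0r addr0 [y + _]addrC subrK subr0 mulr1 => ->.
apply: le_trans (@linear_coef_le ('d f _) (\sum_i M i) _ (x - y)) _.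
  move=> i; have [_ /(_ _)/le_trans] := ME i; apply.
  rewrite (bigD1 i)//= lerDl sumr_ge0// => j _.
  by have [] := ME j.
by rewrite -mulrA ler_wpM2l.
Qed.

(** The norm itself has limited smoothness, so the bump is a product of
    one-variable bumps in the coordinates. *)
Lemma smooth_bump (r : R) : 0 < r -> exists chi : E -> R^o,
  [/\ smooth setT chi, forall x, 0 <= chi x <= 1,
    forall x, `|x| <= r -> chi x = 1 &
    exists2 C : set E, compact C & forall x, ~ C x -> chi x = 0].
Proof.
move=> r0; have [C C0 CE] := coef_bound.
pose A := C * r; have A0 : 0 < A by rewrite mulr_gt0.
pose b (s : R^o) : R^o := step (A^-1 * s + 2) * step (- A^-1 * s + 2).
have bs k : Ck k setT b by apply: CkM; exact: smooth_step_affine.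
have b01 s : 0 <= b s <= 1.
  by rewrite mulr_ge0 ?step_ge0// mulr_ile1 ?step_ge0 ?step_le1.
have AV (s : R) : `|A^-1 * s| = A^-1 * `|s|.
  by rewrite normrM gtr0_norm ?invr_gt0.
have b1 (s : R) : `|s| <= A -> b s = 1.
  move=> sA; have : `|A^-1 * s| <= 1 by rewrite AV ler_pdivrMl// mulr1.
  by rewrite ler_norml => /andP[h1 h2]; rewrite /b !step_ge1 ?mulr1//; lra.
have b0 (s : R) : b s != 0 -> `|s| <= 2 * A.
  apply: contra_neqT; rewrite -ltNge mulrC -ltr_pdivlMl// -AV => h; rewrite /b.
  have [h0|h0] := ler0P (A^-1 * s); move: h.
    rewrite ler0_norm// => h; rewrite [step (A^-1 * s + 2)]step_le0 ?mul0r//; lra.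
  rewrite gtr0_norm// => h.
  rewrite [step (- A^-1 * s + 2)]step_le0 ?mulr0//; lra.
exists (fun x => \prod_i b (coef i x)); split.
- move=> k; apply: Ck_prod => i.
  by apply: (@Ck_comp _ _ _ b (coef i)) => //; exact: smooth_coef.
- move=> x; apply/andP; split.
    by apply: prodr_ge0 => i _; have /andP[] := b01 (coef i x).
  apply: (@le_trans _ _ (\prod_(i : 'I_n) 1)); last by rewrite big1.
  by apply: ler_prod => i _; exact: b01.
- move=> x xr; apply: big1 => i _; apply: b1.
  by rewrite (le_trans (CE _ _))// ler_wpM2l// ltW.
exists [set x : E | forall i, `|coef i x| <= 2 * A].
  exact: compact_coef_box.
move=> x /= Cx; apply/eqP; apply: contrapT => /negP/prodf_neq0 px.
by apply: Cx => i; apply: b0; exact: px.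
Qed.

End Coordinates.

(** * Smooth partitions of unity on a grid *)

Section Hat.
Context {R : realType}.

(** The integer translates of [hat] form a partition of unity because their
    sums telescope. *)
Definition hat (s : R) : R := step (s + 1) - step s.

Lemma hat_gt1 s : 1 <= `|s| -> hat s = 0.
Proof.
rewrite /hat ler_normr => /orP[] h.
  by rewrite !step_ge1 ?subrr//; lra.
by rewrite !step_le0 ?subrr//; lra.
Qed.

Lemma hat_ge0 s : 0 <= hat s.
Proof.
rewrite /hat; have [s0|s0] := leP s 0.
  by rewrite [step s]step_le0 ?subr0 ?step_ge0.
by rewrite [step (s + 1)]step_ge1 ?subr_ge0 ?step_le1//; lra.
Qed.

Lemma smooth_hat : smooth setT (hat : R^o -> R^o).
Proof.
move=> k; rewrite (_ : (hat : R^o -> R^o) = (fun s : R^o =>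
    (step (1 * s + 1) : R^o) + -1 * step (1 * s + 0))); last first.
  by apply/funext => s; rewrite !mul1r addr0 mulN1r.
apply: CkD; first exact: smooth_step_affine.
by apply: CkM; [exact: Ck_cst|exact: smooth_step_affine].
Qed.

Lemma sum_hat N s : \sum_(j < N) hat (s - j%:R) = step (s + 1) - step (s + 1 - N%:R).
Proof.
elim: N => [|N IH]; first by rewrite big_ord0 subr0 subrr.
rewrite big_ord_recr/= IH /hat (_ : s - N%:R + 1 = s + 1 - N%:R); last by ring.
rewrite (_ : s + 1 - N.+1%:R = s - N%:R); last by rewrite -natr1; ring.
by rewrite addrA subrK.
Qed.

Lemma sum_hat_le1 N s : \sum_(j < N) hat (s - j%:R) <= 1.
Proof.
by rewrite sum_hat lerBlDr (le_trans (step_le1 _))// lerDl step_ge0.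
Qed.

Lemma sum_hat_eq1 N s : 0 <= s -> s + 1 <= N%:R ->
  \sum_(j < N) hat (s - j%:R) = 1.
Proof.
move=> s0 sN; rewrite sum_hat step_ge1 ?step_le0 ?subr0//; lra.
Qed.

(** At most two terms are nonzero, which is expressed by dominating the
    derivative by three translates of [hat]. *)
Lemma sum_diff_hat_bounded : exists2 D : R, 0 <= D &
  forall N (s : R), \sum_(j < N) `|'d (hat : R^o -> R^o) (s - j%:R : R^o) 1| <= D.
Proof.
pose dh (s : R) : R := `|'d (hat : R^o -> R^o) (s : R^o) 1|.
have dhc : continuous dh.
  move=> s.
  apply: (@continuous_comp _ _ _ (fun s : R^o => 'd (hat : R^o -> R^o) s 1)).
    exact: (smooth_continuous (smooth_diff _ smooth_hat)).
  exact: norm_continuous.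
have dh_ge0 r : 0 <= dh r by exact: normr_ge0.
have dh0 (r : R) : 1 <= `|r| -> dh r = 0.
  move=> r1; have hmin z : hat r <= hat z by rewrite (hat_gt1 r1) hat_ge0.
  have hd z : differentiable (hat : R^o -> R^o) z.
    exact: smooth_differentiable smooth_hat.
  by rewrite /dh (@diff_at_min R R^o (hat : R^o -> R^o) r 1 hd hmin) normr0.
suff : exists2 D : R, 0 <= D & forall N s, \sum_(j < N) dh (s - j%:R) <= D by [].
clearbody dh.
have [c _ cmax] := @EVT_max R dh (-1) 1 (ltW (gtrN (@ltr01 R)))
  (continuous_subspaceT dhc).
exists (dh c * 3) => [|N s]; first by rewrite mulr_ge0.
have dom r : dh r <= dh c * (hat (r + 1) + hat r + hat (r - 1)).
  have [r1|r1] := leP 1 `|r|.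
    rewrite dh0//; apply: mulr_ge0 => //.
    by apply: addr_ge0; [apply: addr_ge0|]; exact: hat_ge0.
  have -> : hat (r + 1) + hat r + hat (r - 1) = 1.
    move: r1; rewrite ltr_norml => /andP[r1 r2].
    rewrite /hat [step (r + 1 + 1)]step_ge1; last by lra.
    rewrite [step (r - 1)]step_le0; last by lra.
    by rewrite subrK subr0 addrA subrK subrK.
  by rewrite mulr1 cmax// in_itv/= -ler_norml ltW.
apply: (@le_trans _ _ (\sum_(j < N) dh c * (hat (s + 1 - j%:R)
    + hat (s - j%:R) + hat (s - 1 - j%:R)))).
  apply: ler_sum => j _; rewrite (le_trans (dom _))//.
  by rewrite [s - j%:R + 1]addrAC [s - j%:R - 1]addrAC.
rewrite -mulr_sumr ler_wpM2l// big_split big_split/=.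
have := sum_hat_le1 N (s + 1); have := sum_hat_le1 N s.
by have := sum_hat_le1 N (s - 1); lra.
Qed.

End Hat.

Section PartitionOfUnity.
Context {R : realType} {E : finNormedModType R}.
Local Notation n := (\dim {:E}).

Lemma diff_invariant (f : E -> R^o) x v : differentiable f x ->
  (forall t : R, f (x + t *: v) = f x) -> 'd f x v = 0.
Proof.
move=> fd fv.
have fd0 : differentiable f (x + (0 : R) *: v) by rewrite scale0r addr0.
have := diff_derive fd0; rewrite scale0r addr0.
rewrite (_ : (fun t : R => f (x + t *: v)) = cst (f x)); last exact/funext.
move=> h; have := @derive_val _ _ _ _ _ _ _ h.
by rewrite derive_cst => <-.
Qed.

Lemma diff_affine (a b : R) (i : 'I_n) x :
  differentiable (fun z : E => a + b * coef i z : R^o) x /\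
  forall v, 'd (fun z : E => a + b * coef i z : R^o) x v = b * coef i v.
Proof.
have dc : differentiable (coef i) x.
  exact: smooth_differentiable (smooth_coef i).
have dcc (c : R^o) : differentiable (fun _ : E => c) x.
  exact: differentiable_cst.
have dbc : differentiable (fun z : E => b * coef i z : R^o) x.
  exact: differentiableM.
split=> [|v]; first exact: differentiableD.
have d0 (c : R^o) : 'd (fun _ : E => c) x v = 0 by rewrite (diff_cst c).
rewrite diffDE// diffME// !d0 add0r mulr0 addr0.
by rewrite (diff_lin x (@fin_linear_continuous _ _ _ (coef i))).
Qed.

(** A tensor product of hat functions at the nodes of a grid of mesh [h] in
    coordinates. The constants [C1] and [C2] do not depend on [h]; this is what
    makes Taylor polynomials glued along the partition converge in [C^1]. *)
Lemma partition_of_unity (r : R) : 0 < r -> exists C1 C2 : R,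
  [/\ 0 < C1, 0 < C2 & forall h : R, 0 < h ->
  exists (J : finType) (psi : J -> E -> R^o),
  [/\ forall k, smooth setT (psi k) /\ (forall x, 0 <= psi k x),
      forall x, \sum_k psi k x <= 1,
      forall x, `|x| <= r -> \sum_k psi k x = 1,
      forall k x y, psi k x != 0 -> psi k y != 0 -> `|x - y| <= C1 * h &
      (forall x v, \sum_k `|'d (psi k) x v| <= C2 / h * `|v|) /\
      exists2 C : set E, compact C & forall k x, ~ C x -> psi k x = 0]].
Proof.
move=> r0; have [Cc Cc0 CcE] := @coef_bound R E.
have [Cn Cn0 CnE] := @norm_coef_le R E.
have [D D0 DE] := @sum_diff_hat_bounded R.
exists (Cn * 2), (Cc * n%:R * D + 1); split.
- by rewrite mulr_gt0.
- by rewrite ltr_wpDl// !mulr_ge0// ltW.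
move=> h h0; pose A := Cc * r; have A0 : 0 < A by rewrite mulr_gt0.
have hN0 : h != 0 by rewrite gt_eqF.
pose N := (Num.bound (2 * A / h)).+1.
have NA : 2 * A / h + 1 <= N%:R.
  rewrite /N -[in leRHS]natr1 lerD2r ltW// archi_boundP// divr_ge0 ?ltW//.
  by rewrite mulr_gt0.
pose sg (i : 'I_n) (x : E) : R := (A + coef i x) / h.
pose hf (i : 'I_n) (j : 'I_N) (x : E) : R^o := hat (sg i x - j%:R).
have hfs i j : smooth setT (hf i j).
  move=> k; apply: (@Ck_comp _ _ _ hat (fun x => sg i x - j%:R : R^o)).
    exact: smooth_hat.
  rewrite (_ : (fun x => _) = (fun x => (A / h - j%:R) + h^-1 * coef i x)).
    by apply: CkD; [exact: Ck_cst|apply: CkM; [exact: Ck_cst|exact: smooth_coef]].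
  by apply/funext => x; rewrite /sg mulrDl [coef i x * _]mulrC addrAC.
have hf0 i j x : 0 <= hf i j x by exact: hat_ge0.
have hfN0 i j x : hf i j x != 0 -> `|sg i x - j%:R| <= 1.
  by apply: contra_neqT; rewrite -ltNge => /ltW; exact: hat_gt1.
pose psi (k : {ffun 'I_n -> 'I_N}) (x : E) : R^o := \prod_i hf i (k i) x.
have psiN0 k x : psi k x != 0 -> forall i, `|sg i x - (k i)%:R| <= 1.
  by move=> /prodf_neq0 px i; apply: hfN0; exact: px.
have psi0 k x : 0 <= psi k x by apply: prodr_ge0.
have sumE x : \sum_k psi k x = \prod_i \sum_j hf i j x.
  by rewrite (@bigA_distr_bigA _ 0 1 _ _ _ _ (fun i j => hf i j x : R)).
exists {ffun 'I_n -> 'I_N}, psi; split.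
- by move=> k; split=> // m; apply: Ck_prod => i; exact: hfs.
- move=> x; rewrite sumE.
  apply: (@le_trans _ _ (\prod_(i : 'I_n) 1)); last by rewrite big1.
  by apply: ler_prod => i _; rewrite sumr_ge0// sum_hat_le1.
- move=> x xr; rewrite sumE big1// => i _.
  have : `|coef i x| <= A.
    by rewrite (le_trans (CcE _ _))// ler_wpM2l// ltW.
  rewrite ler_norml => /andP[x1 x2]; apply: sum_hat_eq1.
    by rewrite divr_ge0 ?(ltW h0)//; lra.
  apply: le_trans NA; rewrite lerD2r ler_pM2r ?invr_gt0//; lra.
- move=> k x y /psiN0 kx /psiN0 ky.
  rewrite -mulrA; apply: CnE; last by rewrite mulr_ge0// ltW.
  move=> i; rewrite linearB/=.
  have -> : coef i x - coef i y = h * ((sg i x - (k i)%:R) - (sg i y - (k i)%:R)).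
    by rewrite /sg; field.
  rewrite normrM gtr0_norm// [2 * h]mulrC ler_pM2l//.
  rewrite (le_trans (ler_normB _ _))//.
  by have := kx i; have := ky i; lra.
split; last first.
  exists [set x : E | forall i, `|coef i x| <= h * (N%:R + 1) + A].
    exact: compact_coef_box.
  move=> k x Cx; apply/eqP/negPn/negP => /psiN0 kx; apply: Cx => i /=.
  have := kx i; rewrite !ler_norml => /andP[h1 h2].
  have kN : (k i)%:R + 1 <= N%:R :> R by rewrite natr1 ler_nat ltn_ord.
  have e : coef i x = h * sg i x - A by rewrite /sg; field.
  have k0 : 0 <= (k i)%:R :> R by exact: ler0n.
  rewrite e; apply/andP; split.
    rewrite lerBrDl; nra.
  nra.
(* Along a basis vector only one factor of [psi k] varies, so the sum over [k]
   of the derivatives is again a product of sums over one coordinate each. *)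
have bound i x : \sum_k `|'d (psi k) x (basis_vec i)| <= D / h.
  pose rest (k : {ffun 'I_n -> 'I_N}) (x : E) : R^o :=
    \prod_(l | l != i) hf l (k l) x.
  have rests k : smooth setT (rest k).
    by move=> m; apply: Ck_prod => l; exact: hfs.
  have sgl (l : 'I_n) (t : R) :
      sg l (x + t *: basis_vec i) = sg l x + t * (l == i)%:R / h.
    by rewrite /sg linearD linearZ/= coef_basis_vec addrA mulrDl.
  have drest k : 'd (rest k) x (basis_vec i) = 0.
    apply: diff_invariant; first exact: smooth_differentiable.
    move=> t; apply: eq_bigr => l li.
    by rewrite /hf sgl (negPf li) mulr0 mul0r addr0.
  pose dhat (s : R) : R := 'd (hat : R^o -> R^o) (s : R^o) 1.
  have dhf j : 'd (hf i j) x (basis_vec i) = dhat (sg i x - j%:R) / h.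
    have sgE : (fun x => sg i x - j%:R : R^o) =
        (fun x => (A / h - j%:R) + h^-1 * coef i x).
      by apply/funext => z; rewrite /sg mulrDl [coef i z * _]mulrC addrAC.
    have [dsg dsgE] := diff_affine (A / h - j%:R) h^-1 i x.
    rewrite /hf (@diff_compE _ _ hat (fun x => sg i x - j%:R : R^o)).
    - by rewrite {1}sgE dsgE coef_basis_vec eqxx mulr1 mulrC.
    - by rewrite sgE.
    - exact: smooth_differentiable smooth_hat.
  have dpsi k : 'd (psi k) x (basis_vec i) =
      dhat (sg i x - (k i)%:R) / h * rest k x.
    have -> : psi k = (fun x => hf i (k i) x * rest k x).
      by apply/funext => y; rewrite /psi (bigD1 i).
    rewrite diffME; [|exact: smooth_differentiable|exact: smooth_differentiable].
    by rewrite drest dhf mulr0 add0r mulrC.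
  pose Q (l : 'I_n) (j : 'I_N) : R :=
    if l == i then `|dhat (sg i x - j%:R)| / h else hf l j x.
  have QE k : `|'d (psi k) x (basis_vec i)| = \prod_l Q l (k l).
    rewrite dpsi (bigD1 i)//= /Q eqxx !normrM.
    rewrite normfV (gtr0_norm h0); congr (_ * _).
    rewrite ger0_norm; last by apply: prodr_ge0.
    by apply: eq_bigr => l /negPf ->.
  rewrite (eq_bigr _ (fun k _ => QE k)).
  rewrite -(@bigA_distr_bigA _ 0 1 _ _ _ _ Q) (bigD1 i)//=.
  rewrite -[leRHS]mulr1; apply: ler_pM.
  - by apply: sumr_ge0 => j _; rewrite /Q eqxx divr_ge0 ?normr_ge0// ltW.
  - by apply: prodr_ge0 => l li; apply: sumr_ge0 => j _; rewrite /Q (negPf li).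
  - under eq_bigr do rewrite /Q eqxx.
    by rewrite -mulr_suml ler_pM2r ?invr_gt0// DE.
  - apply: (@le_trans _ _ (\prod_(l : 'I_n | l != i) 1)); last by rewrite big1.
    apply: ler_prod => l li; under eq_bigr do rewrite /Q (negPf li).
    by rewrite sumr_ge0// sum_hat_le1.
move=> x v.
apply: (@le_trans _ _ (\sum_k \sum_i `|coef i v| * `|'d (psi k) x (basis_vec i)|)).
  apply: ler_sum => k _; rewrite diff_coef (le_trans (ler_norm_sum _ _ _))//.
  by apply: ler_sum => i _; rewrite normrM.
rewrite exchange_big/=.
apply: (@le_trans _ _ (\sum_(i : 'I_n) Cc * `|v| * (D / h))).
  apply: ler_sum => i _; rewrite -mulr_sumr ler_pM// ?sumr_ge0//.
  exact: CcE.
rewrite sumr_const card_ord -[leLHS]mulr_natl.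
rewrite !mulrDl mul1r -[leLHS]addr0 lerD//; last first.
  by rewrite mulr_ge0// invr_ge0 ltW.
rewrite le_eqVlt; apply/orP; left; apply/eqP; ring.
Qed.

End PartitionOfUnity.

(** * Smooth approximation of C^1 functions on a convex body *)

Section Approximation.
Context {R : realType} {E : finNormedModType R}.
Local Notation n := (\dim {:E}).
Variable (K : set E) (G : E -> R^o).
Hypotheses (cK : compact K) (convK : convex_set K).
Hypothesis dG : forall x, K x -> differentiable G x.
Hypothesis dGc : forall x v, K x -> {for x, continuous (fun z => 'd G z v)}.

Lemma diff_near (w : R) x : 0 < w -> K x ->
  \forall y \near x, forall v, `|'d G x v - 'd G y v| <= w * `|v|.
Proof.
move=> w0 Kx; have [S S0 SE] := @sum_coef_bound R E.
have wS0 : 0 < w / S by rewrite divr_gt0.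
have : \forall y \near x,
    forall i, `|'d G x (basis_vec i) - 'd G y (basis_vec i)| <= w / S.
  apply: filter_forall => i; have := @dGc x (basis_vec i) Kx.
  by move=> /cvgrPdist_le; apply.
apply: filterS => y xy v.
pose q : 'Hom(E, R^o) := linfun ('d G x) - linfun ('d G y).
have qE z : q z = 'd G x z - 'd G y z by exact: linfunBE.
rewrite -qE; apply: le_trans (@linear_coef_le R E q (w / S) _ v) _.
  by move=> i; have := xy i; rewrite -qE.
apply: (@le_trans _ _ (w / S * (S * `|v|))).
  by rewrite ler_wpM2l ?(ltW wS0).
by rewrite mulrA divfK ?gt_eqF.
Qed.

(** Heine-Cantor for the differential on [K]. *)
Lemma diff_unif_continuous (w : R) : 0 < w -> exists2 d : R, 0 < d &
  forall x y, K x -> K y -> `|x - y| < d ->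
  forall v, `|'d G x v - 'd G y v| <= w * `|v|.
Proof.
move=> w0.
pose P (d : R) (x : E) := forall y, K y -> `|x - y| < d ->
  forall v, `|'d G x v - 'd G y v| <= w * `|v|.
have : \forall d \near (0 : R)^'+, K `<=` P d.
  have /near_covering_withinP := (compact_near_coveringP K).1 cK.
  apply => x Kx.
  have w20 : 0 < w / 2 by rewrite divr_gt0.
  have /nbhs_normP[r /= r0 rE] := diff_near w20 Kx.
  exists (ball x (r / 2), [set d : R | d < r / 2]) => /=.
    split; first by apply: nbhsx_ballx; rewrite divr_gt0.
    by apply: nbhs_right_lt; rewrite divr_gt0.
  move=> [z d] [/= xz dr] Kz y Ky zy v.
  have xz' : `|x - z| < r / 2 by move: xz; rewrite -ball_normE.
  have split3 (s t u : R) : s - t = (u - t) - (u - s) by ring.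
  rewrite (split3 _ _ ('d G x v)) (le_trans (ler_normB _ _))//.
  rewrite (splitr w) mulrDl lerD//.
    apply: (rE y); rewrite /= -(subrK z x) -addrA.
    by rewrite (le_lt_trans (ler_normD _ _))// (splitr r) ltrD// (lt_trans zy).
  by apply: (rE z) => /=; rewrite (lt_trans xz')// ltr_pdivrMr// ltr_pMr// ltr1n.
move=> h; near (0 : R)^'+ => d.
exists d => [|x y Kx Ky xy v]; first by near: d; exact: nbhs_right_gt.
have Pd : K `<=` P d by near: d.
exact: Pd Kx y Ky xy v.
Unshelve. all: by end_near. Qed.

Lemma diff_bounded : exists2 M : R, 0 <= M &
  forall x v, K x -> `|'d G x v| <= M * `|v|.
Proof.
have [S S0 SE] := @sum_coef_bound R E.
have /choice[M ME] : forall i : 'I_n, exists M, 0 <= M /\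
    forall x, K x -> `|'d G x (basis_vec i)| <= M.
  move=> i.
  have [K0|K0] := pselect (K !=set0); last first.
    by exists 0; split=> // x Kx; exfalso; apply: K0; exists x.
  have nc : {within K, continuous (fun x => `|'d G x (basis_vec i)|)}.
    apply: continuous_in_subspaceT => x /[!inE] Kx.
    by apply: cvg_norm; exact: dGc.
  have [c _ cmax] := compact_EVT_max K0 cK nc.
  by exists `|'d G c (basis_vec i)|; split=> // x Kx; apply: cmax; rewrite inE.
have M0 : 0 <= \sum_i M i by apply: sumr_ge0 => i _; have [] := ME i.
exists ((\sum_i M i) * S) => [|x v Kx]; first by rewrite mulr_ge0// ltW.
apply: le_trans (@linear_coef_le R E ('d G x) (\sum_i M i) _ v) _.
  move=> i; have [_ /(_ x Kx)/le_trans] := ME i; apply.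
  rewrite (bigD1 i)//= lerDl sumr_ge0// => j _.
  by have [] := ME j.
by rewrite -mulrA ler_wpM2l.
Qed.

(** The mean value theorem is applied on the segment from [p] to [x]; by
    convexity it stays in [K], where the differential is under control. *)
Lemma taylor1 (w d : R) p x : K p -> K x -> `|x - p| < d ->
  (forall x y, K x -> K y -> `|x - y| < d ->
    forall v, `|'d G x v - 'd G y v| <= w * `|v|) ->
  `|G x - G p - 'd G p (x - p)| <= w * `|x - p|.
Proof.
move=> Kp Kx xp dGw.
have Kseg (t : R) : 0 <= t <= 1 -> K (p + t *: (x - p)) by exact: convex_segment.
pose q (t : R) : R := G (p + t *: (x - p)).
have dq (t : R) : t \in `[0, 1] ->
    is_derive t 1 q ('d G (p + t *: (x - p)) (x - p)).
  rewrite in_itv/= => t01; apply: diff_derive; apply: dG; exact: Kseg.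
have qc : {within `[0, 1], continuous q}.
  by apply: derivable_within_continuous => t t01; have [] := dq t t01.
have dq' (t : R) : t \in `]0, 1[ ->
    is_derive t 1 q ('d G (p + t *: (x - p)) (x - p)).
  by rewrite in_itv/= => /andP[/ltW t0 /ltW t1]; apply: dq; rewrite in_itv/= t0.
have [c c01] := MVT_segment ler01 dq' qc.
rewrite /q scale1r scale0r addr0 [p + _]addrC subrK subr0 mulr1 => ->.
move: c01; rewrite in_itv/= => c01; apply: dGw => //; first exact: Kseg.
rewrite addrAC subrr add0r normrZ (le_lt_trans _ xp)//.
have /andP[c0 c1] := c01.
by rewrite ger0_norm// -[leRHS]mul1r ler_wpM2r.
Qed.

(** Whitney-style gluing: on the support of the [k]-th function of a fine
    partition of unity, [G] is replaced by its first-order Taylor polynomial at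
    a point [p k] of [K] in that support. Since the differentials of the
    partition sum to zero, only the Taylor remainders, which are small compared
    with the mesh, meet these differentials, which are of the order of the
    inverse of the mesh. The result is shifted by the lower bound [a] so that
    its range is close to an interval containing [0], as befits a function with
    compact support. *)
Theorem smooth_C1_approx (a b eta : R) : a <= b -> 0 < eta ->
  (forall x, K x -> a <= G x <= b) ->
  exists Phi : E -> R^o,
  [/\ smooth setT Phi,
      exists2 C : set E, compact C & forall x, ~ C x -> Phi x = 0,
      forall x, - eta <= Phi x <= b - a + eta &
      forall x v, K x -> `|'d Phi x v - 'd G x v| <= eta * `|v|].
Proof.
move=> ab eta0 Gab.
have [r r0 Kr] := compact_norm_bounded cK.
have [C1 [C2 [C10 C20 pou]]] := @partition_of_unity R E r r0.
have [M M0 ME] := diff_bounded.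
pose w := eta / (1 + C1 * C2).
have C120 : 0 < 1 + C1 * C2 by rewrite ltr_pwDl// mulr_ge0// ltW.
have w0 : 0 < w by rewrite divr_gt0.
have [d d0 dE] := diff_unif_continuous w0.
pose h := Num.min (d / (2 * C1)) (eta / ((M + 1) * C1)).
have M10 : 0 < M + 1 by rewrite ltr_wpDl.
have h0 : 0 < h by rewrite lt_min !divr_gt0// mulr_gt0.
have hd : C1 * h < d.
  rewrite mulrC -ltr_pdivlMr// (@le_lt_trans _ _ (d / (2 * C1)))//.
    by rewrite ge_min lexx.
  by rewrite invfM mulrA ltr_pM2r ?invr_gt0// ltr_pdivrMr// ltr_pMr// ltr1n.
have hM : M * (C1 * h) <= eta.
  have : h <= eta / ((M + 1) * C1) by rewrite ge_min lexx orbT.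
  rewrite ler_pdivlMr ?mulr_gt0// => /(le_trans _); apply.
  rewrite (_ : h * ((M + 1) * C1) = M * (C1 * h) + C1 * h); last by ring.
  by rewrite lerDl mulr_ge0 ?(ltW C10) ?(ltW h0).
have {pou}[J [psi [psis psile1 psieq1 psid [dpsi [C cC psiC]]]]] := pou h h0.
have /choice[p pE] : forall k, exists p,
    (exists2 q, K q & psi k q != 0) -> K p /\ psi k p != 0.
  move=> k; have [[q Kq q0]|nq] := pselect (exists2 q, K q & psi k q != 0).
    by exists q.
  by exists 0 => /nq.
pose good k := `[< exists2 q, K q & psi k q != 0 >].
have goodE k : good k -> K (p k) /\ psi k (p k) != 0 by move=> /asboolP/pE.
have badE k x : K x -> ~~ good k -> psi k x = 0.
  by move=> Kx /asboolP gk; apply/eqP/negPn/negP => px; apply: gk; exists x.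
pose T k (x : E) : R^o := (G (p k) - a - 'd G (p k) (p k)) + 'd G (p k) x.
have TE k x : T k x = G (p k) - a + 'd G (p k) (x - p k).
  by rewrite /T linearB/= addrA addrAC.
have Ts k : smooth setT (T k).
  move=> m; apply: CkD; first exact: Ck_cst.
  by apply: Ck_linear; exact: fin_linear_continuous.
have dT k x v : 'd (T k) x v = 'd G (p k) v.
  have lc : continuous ('d G (p k)) by exact: fin_linear_continuous.
  have ld : differentiable ('d G (p k)) x by exact: linear_differentiable.
  have cd (c : R^o) : differentiable (fun _ : E => c) x.
    exact: differentiable_cst.
  have dc0 (c : R^o) : 'd (fun _ : E => c) x v = 0 by rewrite (diff_cst c).
  by rewrite /T diffDE// dc0 add0r (diff_lin x lc).
clearbody T.
pose Phi (x : E) : R^o := \sum_(k | good k) psi k x * T k x.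
have psi_ge0 k x : 0 <= psi k x by have [_] := psis k.
have psi_sm k : smooth setT (psi k) by have [] := psis k.
have psi_d k x : differentiable (psi k) x by exact: smooth_differentiable.
have T_d k x : differentiable (T k) x by exact: smooth_differentiable.
exists Phi; split.
- by move=> m; apply: Ck_sum => k; apply: CkM; [exact: psi_sm|exact: Ts].
- exists C => // x Cx; apply: big1 => k _; by rewrite psiC// mul0r.
- move=> x.
  have Tb k : good k -> psi k x != 0 -> - eta <= T k x <= b - a + eta.
    move=> /goodE[Kp pp] px; have /andP[G1 G2] := Gab _ Kp.
    have : `|'d G (p k) (x - p k)| <= eta.
      rewrite (le_trans (ME _ _ Kp))// (le_trans _ hM)// ler_wpM2l//.
      exact: (psid k).
    by rewrite TE ler_norml => /andP[h1 h2]; apply/andP; split; lra.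
  have sum1 : \sum_(k | good k) psi k x <= 1.
    rewrite (le_trans _ (psile1 x))// [leRHS](bigID good)/= lerDl.
    by apply: sumr_ge0.
  have sum0 : 0 <= \sum_(k | good k) psi k x by apply: sumr_ge0.
  apply/andP; split.
    apply: (@le_trans _ _ (\sum_(k | good k) psi k x * - eta)).
      rewrite -mulr_suml mulrN lerNl opprK -[leRHS]mul1r ler_wpM2r//.
      exact: ltW.
    apply: ler_sum => k gk.
    have [->|px] := eqVneq (psi k x) 0; first by rewrite !mul0r.
    have /andP[Tlo _] := Tb k gk px.
    by apply: ler_wpM2l; [exact: psi_ge0|exact: Tlo].
  apply: (@le_trans _ _ (\sum_(k | good k) psi k x * (b - a + eta))).
    apply: ler_sum => k gk.
    have [->|px] := eqVneq (psi k x) 0; first by rewrite !mul0r.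
    have /andP[_ Thi] := Tb k gk px.
    by apply: ler_wpM2l; [exact: psi_ge0|exact: Thi].
  rewrite -mulr_suml -[leRHS]mul1r ler_wpM2r//; lra.
move=> x v Kx.
have dpsi0 k : psi k x = 0 -> 'd (psi k) x v = 0.
  by move=> px; apply: diff_at_min => // z; rewrite px.
(* Indices outside [good] contribute nothing at points of [K]; moreover a
   nonnegative function is critical where it vanishes. *)
have sum_good (f : J -> R) : (forall k, psi k x = 0 -> f k = 0) ->
    \sum_(k | good k) f k = \sum_k f k.
  move=> f0; rewrite [RHS](bigID good)/= [X in _ + X]big1 ?addr0// => k gk.
  by apply: f0; exact: badE.
have psi1 : \sum_(k | good k) psi k x = 1.
  by rewrite sum_good//; apply: psieq1; exact: Kr.
have dpsi1 : \sum_(k | good k) 'd (psi k) x v = 0.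
  rewrite sum_good//.
  have [_ <-] := @diff_sum R E J (index_enum J) xpredT psi x v (psi_d ^~ x).
  apply: diff_at_max => z; last by rewrite (psieq1 x (Kr _ Kx)).
  by have [] := @diff_sum R E J (index_enum J) xpredT psi z v (psi_d ^~ z).
have -> : 'd Phi x v = \sum_(k | good k)
    (psi k x * 'd G (p k) v + T k x * 'd (psi k) x v).
  have [_ ->] := @diff_sum R E J (index_enum J) good
    (fun k z => psi k z * T k z) x v
    (fun k => differentiableM (psi_d k x) (T_d k x)).
  by apply: eq_bigr => k _; rewrite (@diffME R E _ _ x v (psi_d k x) (T_d k x)) dT.
have -> : 'd G x v = \sum_(k | good k)
    (psi k x * 'd G x v + (G x - a) * 'd (psi k) x v).
  rewrite big_split/= -(mulr_suml _ _ _ ('d G x v)) -(mulr_sumr _ _ _ (G x - a)).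
  by rewrite psi1 dpsi1 mul1r mulr0 addr0.
rewrite -sumrB (le_trans (ler_norm_sum _ _ _))//.
have regroup (s0 s1 g gp g1 u0 u1 : R) :
    s0 * g1 + (gp - a + u1) * s1 - (s0 * u0 + (g - a) * s1) =
    s0 * (g1 - u0) + (- (g - gp - u1)) * s1 by ring.
have term k : good k ->
    `|psi k x * 'd G (p k) v + T k x * 'd (psi k) x v
      - (psi k x * 'd G x v + (G x - a) * 'd (psi k) x v)| <=
    psi k x * (w * `|v|) + w * (C1 * h) * `|'d (psi k) x v|.
  move=> /goodE[Kp pp].
  have [px|px] := eqVneq (psi k x) 0.
    by rewrite px dpsi0// !mul0r !mulr0 !addr0 subrr normr0 mulr0.
  have xp : `|x - p k| <= C1 * h by exact: (psid k).
  have xpd : `|x - p k| < d by exact: le_lt_trans hd.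
  have rem := taylor1 Kp Kx xpd dE.
  have px' : `|p k - x| < d by rewrite distrC.
  have gap := dE (p k) x Kp Kx px' v.
  rewrite TE regroup.
  rewrite (le_trans (ler_normD _ _))// lerD//.
    by rewrite normrM ger0_norm// ler_wpM2l.
  rewrite normrM normrN ler_wpM2r// (le_trans rem)// ler_wpM2l//.
  exact: ltW.
apply: (@le_trans _ _ (\sum_(k | good k)
    (psi k x * (w * `|v|) + w * (C1 * h) * `|'d (psi k) x v|))).
  by apply: ler_sum.
rewrite big_split/= -mulr_suml psi1 mul1r -mulr_sumr.
have dsum : \sum_(k | good k) `|'d (psi k) x v| <= C2 / h * `|v|.
  by rewrite sum_good// => k /dpsi0 ->; rewrite normr0.
have wh0 : 0 <= w * (C1 * h).
  by apply: mulr_ge0; [exact: ltW|apply: mulr_ge0; exact: ltW].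
have := ler_wpM2l wh0 dsum.
have -> : w * (C1 * h) * (C2 / h * `|v|) = w * (C1 * C2) * `|v|.
  by field; rewrite gt_eqF.
have -> : eta = w * (1 + C1 * C2) by rewrite /w divfK// gt_eqF.
move=> h1; rewrite mulrDr mulr1 mulrDl lerD2l//.
Qed.

End Approximation.

(** * Flows of product Hamiltonians *)

Section LinearComposition.
Context {R : realType} {E W : normedModType R} (l : {linear E -> W}).
Hypothesis lc : continuous l.

Lemma diff_comp_linear (f : W -> R^o) x : differentiable f (l x) ->
  differentiable (f \o l) x /\
  forall v, 'd (f \o l) x v = 'd f (l x) (l v).
Proof.
move=> fd; have ld : differentiable l x by exact: linear_differentiable.
split=> [|v]; first exact: differentiable_comp.
by rewrite (diff_comp ld fd)/= (diff_lin x lc).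
Qed.

Lemma Ck_comp_linear k (f : W -> R^o) : Ck k setT f -> Ck k setT (f \o l).
Proof.
elim: k f => [|k IH] f.
  by move=> fc x _; apply: continuous_comp; [exact: lc|exact: fc].
move=> /CkSP[df ddf]; apply/CkSP; split=> [x|v].
  by have [] := diff_comp_linear (df (l x)).
rewrite (_ : (fun _ => _) = (fun y => 'd f y (l v)) \o l); first exact: IH.
by apply/funext => x; have [_ ->] := diff_comp_linear (df (l x)).
Qed.

End LinearComposition.

Section Curves.
Context {R : realType} {W : normedModType R}.

Lemma is_derive_scale_vec (u : R -> R) (du t : R) (b : W) :
  is_derive t 1 u du -> is_derive t 1 (fun s => u s *: b) (du *: b).
Proof.
move=> [ud <-]; have ud' : differentiable u t by exact/derivable1_diffP.
apply: DeriveDef.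
  by apply/derivable1_diffP; exact: differentiableZl.
rewrite deriveE; last exact: differentiableZl.
by rewrite (diffZl b ud') -deriveE.
Qed.

Lemma is_derive_curve_sum (J : Type) (r : seq J) (F : J -> R -> W)
    (dF : J -> W) (t : R) :
  (forall j, is_derive t 1 (F j) (dF j)) ->
  is_derive t 1 (fun s => \sum_(j <- r) F j s) (\sum_(j <- r) dF j).
Proof.
move=> FdF; elim: r => [|j r IH].
  under eq_fun do rewrite big_nil.
  by rewrite big_nil; exact: is_derive_cst.
under eq_fun do rewrite big_cons.
by rewrite big_cons; exact: (is_deriveD (FdF j) IH).
Qed.

End Curves.

Section HamiltonianFlow.
Context {R : realType} {V : finNormedModType R}.
Local Notation Vd := ('Hom(V, R^o)).
Local Notation n := (\dim {:V}).
Local Notation phase_space := (V * 'Hom(V, R^o))%type.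

Let linear_fst : {linear phase_space -> V} := fst.
Let linear_snd : {linear phase_space -> Vd} := snd.

Let forget_time : {linear (phase_space * R^o)%type -> phase_space} := fst.

Let fst_cont : continuous (fst : phase_space -> V).
Proof. by move=> x; exact: cvg_fst. Qed.

Let snd_cont : continuous (snd : phase_space -> Vd).
Proof. by move=> x; exact: cvg_snd. Qed.

Definition dual_vec (i : 'I_n) : Vd := linfun (coef i).

Lemma dual_vecE i x : dual_vec i x = coef i x.
Proof. exact: lfunE. Qed.

Lemma dual_expansion (y : Vd) : y = \sum_i y (basis_vec i) *: dual_vec i.
Proof.
apply/lfunP => x; rewrite [x in LHS](coef_expansion x) linear_sum sum_lfunE.
apply: eq_bigr => i _; rewrite linearZ scale_lfunE dual_vecE.
by rewrite -![_ *: _]/(_ * _) mulrC.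
Qed.

Variables (Phi : V -> R^o) (chi : Vd -> R^o).
Hypotheses (Phi_smooth : smooth setT Phi) (chi_smooth : smooth setT chi).
Variables (CPhi : set V) (Cchi : set Vd).
Hypotheses (cCPhi : compact CPhi) (cCchi : compact Cchi).
Hypothesis Phi0 : forall x, ~ CPhi x -> Phi x = 0.
Hypothesis chi0 : forall y, ~ Cchi y -> chi y = 0.

Definition product_hamiltonian (zt : phase_space * R^o) : R^o :=
  Phi zt.1.1 * chi zt.1.2.

Lemma smooth_product_hamiltonian : smooth setT product_hamiltonian.
Proof.
move=> k; have Pk := Ck_comp_linear (l := linear_fst) fst_cont (Phi_smooth k).
have ck := Ck_comp_linear (l := linear_snd) snd_cont (chi_smooth k).
have forget_time_cont : continuous forget_time by move=> x; exact: cvg_fst.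
by apply: CkM; [exact: (Ck_comp_linear (l := forget_time) _ Pk)
  |exact: (Ck_comp_linear (l := forget_time) _ ck)].
Qed.

Lemma hamiltonian_product T1 T2 : hamiltonian T1 T2 product_hamiltonian.
Proof.
split.
  exists setT; last exact: smooth_product_hamiltonian.
  by split=> //; exact: openT.
exists (CPhi `*` Cchi); first exact: compact_setX.
move=> [x y] t _ /= Cz; rewrite /product_hamiltonian/=.
have [Cx|/Phi0 ->] := pselect (CPhi x); last by rewrite mul0r.
by rewrite chi0 ?mulr0// => Cy; apply: Cz.
Qed.

Lemma diff_product_hamiltonian (t : R^o) (z w : phase_space) :
  'd (fun z' => product_hamiltonian (z', t) : R^o) z w =
  Phi z.1 * 'd chi (z.2) (w.2) + chi z.2 * 'd Phi (z.1) (w.1).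
Proof.
have [dP dPE] := @diff_comp_linear _ _ _ linear_fst fst_cont Phi z
  (smooth_differentiable z.1 Phi_smooth).
have [dc dcE] := @diff_comp_linear _ _ _ linear_snd snd_cont chi z
  (smooth_differentiable z.2 chi_smooth).
rewrite -(dPE w) -(dcE w).
exact: (@diffME _ _ (Phi \o linear_fst) (chi \o linear_snd) z w dP dc).
Qed.

Let J : finType := ('I_n + 'I_n)%type.
Let base (u : J -> R) : V := \sum_i u (inl i) *: basis_vec i.
Let fiber (u : J -> R) : Vd := \sum_i u (inr i) *: dual_vec i.

(** Hamilton's equations in the coordinates given by a basis and its dual
    basis. *)
Let field (u : J -> R) (j : J) : R :=
  match j with
  | inl i => Phi (base u) * 'd chi (fiber u) (dual_vec i)
  | inr i => - (chi (fiber u) * 'd Phi (base u) (basis_vec i))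
  end.

Let prod_bounded_lip (f : V -> R^o) (g : Vd -> R^o) :
  smooth setT f -> smooth setT g ->
  (forall x, ~ CPhi x -> f x = 0) -> (forall y, ~ Cchi y -> g y = 0) ->
  exists L M : R, [/\ 0 <= L, 0 <= M,
    forall u v, `|f (base u) * g (fiber u) - f (base v) * g (fiber v)| <=
      L * \sum_j `|u j - v j| &
    forall u, `|f (base u) * g (fiber u)| <= M].
Proof.
move=> fs gs f0 g0.
have [Lf Lf0 LfE] := smooth_compact_supp_lip fs cCPhi f0.
have [Lg Lg0 LgE] := smooth_compact_supp_lip gs cCchi g0.
have [Mf Mf0 MfE] :=
  continuous_compact_supp_bounded (smooth_continuous fs) cCPhi f0.
have [Mg Mg0 MgE] :=
  continuous_compact_supp_bounded (smooth_continuous gs) cCchi g0.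
pose Sb : R := \sum_i `|basis_vec i : V|.
pose Sd : R := \sum_i `|dual_vec i|.
have Sb0 : 0 <= Sb by exact: sumr_ge0.
have Sd0 : 0 <= Sd by exact: sumr_ge0.
have baseB u v : `|base u - base v| <= Sb * \sum_j `|u j - v j|.
  rewrite /base -sumrB (le_trans (ler_norm_sum _ _ _))// mulr_suml.
  apply: ler_sum => i _; rewrite -scalerBl normrZ mulrC ler_wpM2l//.
  by rewrite (bigD1 (inl i))//= lerDl sumr_ge0.
have fiberB u v : `|fiber u - fiber v| <= Sd * \sum_j `|u j - v j|.
  rewrite /fiber -sumrB (le_trans (ler_norm_sum _ _ _))// mulr_suml.
  apply: ler_sum => i _; rewrite -scalerBl normrZ mulrC ler_wpM2l//.
  by rewrite (bigD1 (inr i))//= lerDl sumr_ge0.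
exists (Mf * (Lg * Sd) + Mg * (Lf * Sb)), (Mf * Mg); split.
- by rewrite addr_ge0// !mulr_ge0.
- by rewrite mulr_ge0.
- move=> u v.
  have split2 (a a' b b' : R) : a * b - a' * b' = a * (b - b') + b' * (a - a').
    by ring.
  rewrite split2 (le_trans (ler_normD _ _))// mulrDl !normrM lerD//.
    by rewrite -!mulrA ler_pM// (le_trans (LgE _ _))// ler_wpM2l// fiberB.
  by rewrite -!mulrA ler_pM// (le_trans (LfE _ _))// ler_wpM2l// baseB.
- by move=> u; rewrite normrM ler_pM.
Qed.

Lemma field_bounded_lip : exists L M : R,
  (forall u v j, `|field u j - field v j| <= L * \sum_k `|u k - v k|) /\
  (forall u j, `|field u j| <= M).
Proof.
have /choice[c cE] : forall j : J, exists c : R * R, [/\ 0 <= c.1, 0 <= c.2,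
    forall u v, `|field u j - field v j| <= c.1 * \sum_k `|u k - v k| &
    forall u, `|field u j| <= c.2].
  case=> i.
    have [L [M [L0 M0 LE ME]]] := prod_bounded_lip Phi_smooth
      (smooth_diff (dual_vec i) chi_smooth) Phi0
      (fun y => diff_compact_supp (dual_vec i) chi_smooth cCchi chi0 (x := y)).
    by exists (L, M).
  have [L [M [L0 M0 LE ME]]] := prod_bounded_lip
    (smooth_diff (basis_vec i) Phi_smooth) chi_smooth
    (fun y => diff_compact_supp (basis_vec i) Phi_smooth cCPhi Phi0 (x := y))
    chi0.
  exists (L, M); split=> // [u v|u] /=.
    by rewrite -opprD normrN ![chi _ * _]mulrC; exact: LE.
  by rewrite normrN mulrC.
exists (\sum_j (c j).1), (\sum_j (c j).2); split=> [u v j|u j].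
  have [_ _ /(_ u v)/le_trans h _] := cE j; apply: h.
  rewrite ler_wpM2r ?sumr_ge0// (bigD1 j)//= lerDl sumr_ge0// => k _.
  by have [] := cE k.
have [_ _ _ /(_ u)/le_trans h] := cE j; apply: h.
rewrite (bigD1 j)//= lerDl sumr_ge0// => k _.
by have [] := cE k.
Qed.

Lemma diff_dual (f : Vd -> R^o) y w :
  'd f y w = \sum_i w (basis_vec i) * 'd f y (dual_vec i).
Proof.
rewrite [w in LHS](dual_expansion w) linear_sum; apply: eq_bigr => i _.
by rewrite linearZ.
Qed.

Lemma hamiltonian_curve (z : phase_space) : exists g : R -> phase_space,
  g 0 = z /\ forall t : R, 0 <= t -> derivable g t 1 /\
    forall w, omega (derive1 g t) w =
      'd (fun z' => product_hamiltonian (z', t : R^o) : R^o) (g t) w.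
Proof.
have [L [M [fL fM]]] := field_bounded_lip.
pose u0 (j : J) : R :=
  match j with inl i => coef i z.1 | inr i => z.2 (basis_vec i) end.
have [u [uz du]] := picard u0 fL fM.
pose b (j : J) : phase_space :=
  match j with inl i => (basis_vec i, 0) | inr i => (0, dual_vec i) end.
have bE (c : J -> R) : \sum_j c j *: b j = (base c, fiber c).
  rewrite [LHS]surjective_pairing; congr pair.
    rewrite -[LHS]/(linear_fst _) linear_sum big_sumType/= [X in _ + X]big1.
      by rewrite addr0.
    by move=> i _; rewrite scaler0.
  rewrite -[LHS]/(linear_snd _) linear_sum big_sumType/= [X in X + _]big1.
    by rewrite add0r.
  by move=> i _; rewrite scaler0.
exists (fun t => \sum_j u t j *: b j); split.
  rewrite uz bE /base /fiber /u0 -coef_expansion -dual_expansion.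
  by case: (z).
move=> t t0.
have dg : is_derive t 1 (fun t => \sum_j u t j *: b j)
    (\sum_j field (u t) j *: b j).
  by apply: is_derive_curve_sum => j; apply: is_derive_scale_vec; exact: du.
split; first by have [] := dg.
move=> w; rewrite derive1E (@derive_val _ _ _ _ _ _ _ dg) !bE.
rewrite diff_product_hamiltonian /omega/= /base /fiber.
rewrite linear_sum sum_lfunE (diff_dual chi) (diff_coef Phi).
rewrite !mulr_sumr -sumrN; congr (_ + _); apply: eq_bigr => i _.
  rewrite linearZ -[LHS]/(Phi (base (u t)) * 'd chi (fiber (u t)) (dual_vec i)
    * w.2 (basis_vec i)).
  by rewrite -mulrA [X in _ * X]mulrC.
rewrite scale_lfunE dual_vecE -[LHS]/(- (- (chi (fiber (u t)) *
  'd Phi (base (u t)) (basis_vec i)) * coef i w.1)).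
by rewrite mulNr opprK -mulrA [X in _ * X]mulrC.
Qed.

(** Where [chi] is [1], hence critical, the flow is the shear along the fibers
    by the differential of [Phi]; elsewhere only existence matters. *)
Lemma product_flow (X : set phase_space) : (forall y, chi y <= 1) ->
  (forall z (t : R), X z -> 0 <= t <= 1 ->
    chi (z.2 - t *: linfun ('d Phi (z.1))) = 1) ->
  exists phi : R -> phase_space -> phase_space,
    hamiltonian_flow 0 1 product_hamiltonian phi /\
    forall z, X z -> phi 1 z = (z.1, z.2 - linfun ('d Phi (z.1))).
Proof.
move=> chi1 Xchi.
pose good z (g : R -> phase_space) := [/\ g 0 = z,
  forall t : R, 0 <= t <= 1 -> derivable g t 1 /\
    forall w, omega (derive1 g t) w =
      'd (fun z' => product_hamiltonian (z', t : R^o) : R^o) (g t) w &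
  X z -> g 1 = (z.1, z.2 - linfun ('d Phi (z.1)))].
have /choice[phi phiE] : forall z, exists g, good z g.
  move=> z; have [Xz|Xz] := pselect (X z); last first.
    have [g [g0 gE]] := hamiltonian_curve z; exists g; split=> // t.
    by move=> /andP[t0 _]; exact: gE.
  pose p : Vd := linfun ('d Phi (z.1)).
  pose g (t : R) : phase_space := z + t *: ((0, - p) : phase_space).
  have gE t : g t = (z.1, z.2 - t *: p).
    rewrite [LHS]surjective_pairing; congr pair; rewrite /g/=.
      by rewrite scaler0 addr0.
    by rewrite scalerN.
  have dg (t : R) : is_derive t 1 g (0, - p).
    have := is_deriveD (is_derive_cst z t (1 : R))
      (is_derive_scale_vec ((0, - p) : phase_space) (is_derive_id t (1 : R))).
    by rewrite add0r scale1r.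
  exists g; split.
  - by rewrite gE scale0r subr0 -surjective_pairing.
  - move=> t t01; split; first by have [] := dg t.
    move=> w; rewrite derive1E (@derive_val _ _ _ _ _ _ _ (dg t)).
    rewrite diff_product_hamiltonian gE /omega/=.
    have chit : chi (z.2 - t *: p) = 1 by exact: Xchi.
    rewrite chit mul1r (diff_at_max (x := z.2 - t *: p)).
    + by rewrite mulr0 add0r linear0 add0r opp_lfunE opprK lfunE.
    + by move=> y; exact: smooth_differentiable.
    + by move=> y; rewrite chit.
  - by move=> _; rewrite gE scale1r.
exists (fun t z => phi z t); split; last by move=> z; have [] := phiE z.
split=> [z|z|z t /andP[t0 t1]].
- by have [] := phiE z.
- apply: derivable_within_continuous => t; rewrite in_itv/= => t01.
  by have [_ /(_ t t01)[]] := phiE z.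
- by have [_ phid _] := phiE z; apply: phid; rewrite (ltW t0) (ltW t1).
Qed.

Lemma total_oscillation_product_le (a b : R) :
  (forall x y, a <= Phi x * chi y <= b) ->
  (total_oscillation 0 1 product_hamiltonian <= (b - a)%:E)%E.
Proof.
move=> ab.
pose rg : set R := range (fun z : phase_space => product_hamiltonian (z, 0)).
have rgE (t : R^o) :
  range (fun z : phase_space => product_hamiltonian (z, t)) = rg by [].
have rg0 : rg !=set0 by exists (Phi 0 * chi 0), (0, 0).
have mu01 : (@lebesgue_measure R `[0%R, 1%R]%classic = 1)%E.
  by rewrite lebesgue_measure_itv/= lte_fin ltr01 oppr0 adde0.
have int01 (c : R) : (\int[@lebesgue_measure R]_(t in `[0%R, 1%R]) c%:E = c%:E)%E.
  rewrite integral_cst; last exact: measurable_itv.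
  by rewrite -[RHS]mule1; congr (_ * _)%E; exact: mu01.
have -> : total_oscillation 0 1 product_hamiltonian = (sup rg - inf rg)%:E.
  rewrite -int01; apply: eq_integral => t _; by rewrite rgE.
rewrite lee_fin lerB//.
  by apply: ge_sup => // _ [z _ <-]; have /andP[] := ab z.1 z.2.
by apply: lb_le_inf => // _ [z _ <-]; have /andP[] := ab z.1 z.2.
Qed.

End HamiltonianFlow.

(** * The displacement energy inequality *)

Section Displacement.
Context {R : realType} {V : finNormedModType R}.
Local Notation phase_space := (V * 'Hom(V, R^o))%type.

Lemma hom_norm_le (p : 'Hom(V, R^o)) (M : R) : 0 <= M ->
  (forall v, `|p v| <= M * `|v|) -> `|p| <= M.
Proof.
move=> M0 pM; apply: dual_norm_lub => x x1.
by rewrite (le_trans (pM x))// -[leRHS]mulr1 ler_wpM2l.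
Qed.

(** The shear by the differential of [Phi] moves each point of the dual unit
    ball by more than its diameter. *)
Lemma displacement_energy_le (K : set V) (Phi : V -> R^o) (C : set V) (a b : R) :
  compact K -> smooth setT Phi -> compact C -> (forall x, ~ C x -> Phi x = 0) ->
  a <= 0 -> 0 <= b -> (forall x, a <= Phi x <= b) ->
  (forall x, K x -> 2 < `|linfun ('d Phi x)|) ->
  (displacement_energy (K `*` [set p | `|p| <= 1]%R) <= (b - a)%:E)%E.
Proof.
move=> cK Ps cC P0 a0 b0 Pab K2.
have [M M0 ME] := diff_bounded cK
  (fun x v _ => smooth_continuous (smooth_diff v Ps) (x := x)).
have pM x : K x -> `|linfun ('d Phi x)| <= M.
  by move=> Kx; apply: hom_norm_le => // v; rewrite lfunE; exact: ME.
have r0 : 0 < 1 + M by rewrite ltr_pwDl.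
have [chi [cs c01 c1 [D cD c0]]] := @smooth_bump R 'Hom(V, R^o) (1 + M) r0.
pose X : set phase_space := K `*` [set p | `|p| <= 1].
have Xchi (z : phase_space) (t : R) : X z -> 0 <= t <= 1 ->
    chi (z.2 - t *: linfun ('d Phi (z.1))) = 1.
  move=> [Kz z1] /andP[t0 t1]; apply: c1.
  rewrite (le_trans (ler_normB _ _))// lerD// normrZ ger0_norm//.
  rewrite -[leRHS]mul1r ler_pM//; exact: pM.
have chi_le1 y : chi y <= 1 by have /andP[] := c01 y.
have [phi [flow phiX]] := product_flow Ps cs cC cD P0 c0 chi_le1 Xchi.
apply: le_trans (total_oscillation_product_le (Phi := Phi) (chi := chi)
    (a := a) (b := b) _); last first.
  move=> x y; have /andP[h0 h1] := c01 y; have /andP[P1 P2] := Pab x.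
  apply/andP; split.
    have [Px|/ltW Px] := leP 0 (Phi x).
      by rewrite (le_trans a0)// mulr_ge0.
    rewrite (le_trans P1)// -[leLHS]mulr1; exact: ler_wnM2l.
  have [Px|Px] := leP 0 (Phi x).
    by rewrite (le_trans _ P2)// -[leRHS]mulr1 ler_wpM2l.
  by rewrite (le_trans _ b0)// mulr_le0_ge0// ltW.
apply: ereal_inf_lbound.
exists 0, 1, (product_hamiltonian Phi chi), phi; split=> //.
  exact: (hamiltonian_product Ps cs cC cD P0 c0).
apply/seteqP; split=> // z [Xz [z' Xz' /esym zE]].
have := K2 z'.1 Xz'.1; rewrite ltNge => /negP; apply.
have z2 : z.2 = z'.2 - linfun ('d Phi (z'.1)) by rewrite zE phiX.
rewrite (_ : linfun _ = z'.2 - z.2); last by rewrite z2 opprB addrC subrK.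
rewrite (le_trans (ler_normB _ _))// -[leRHS]/(1 + 1) lerD//.
  exact: Xz'.2.
exact: Xz.2.
Qed.

End Displacement.

Theorem theorem6p2 (R : realType) (V : finNormedModType R) (k : nat)
    (k_gt0 : (0 < k)%N)
    (smooth_norm : Ck_norm V k) (smooth_dual_norm : Ck_norm 'Hom(V, R^o) k)
    (K : set V) (K_body : convex_body K)
    (F : V -> R^o) (dF : V -> 'Hom(V, R^o)) (F_C1 : C1_on_body K F dF) :
  exists maxF minF mindF : R,
    [/\ is_max (F @` K) maxF,
        is_min (F @` K) minF,
        is_min ((fun x => `|dF x|) @` K) mindF &
        ((2^-1)%:E * displacement_energy (K `*` [set p | `|p| <= 1]%R)
           * mindF%:E <= (maxF - minF)%:E)%E].
Proof.
have [cK convK [x0 /interior_subset Kx0]] := K_body.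
have [U [G [oU KU [dGU dGcU] GF]]] := F_C1.
have K0 : K !=set0 by exists x0.
have dG x : K x -> differentiable G x by move=> /KU/dGU.
have dGc x v : K x -> {for x, continuous (fun z => 'd G z v)}.
  by move=> Kx; apply: dGcU; exact: KU.
have Gc : {within K, continuous G}.
  apply: continuous_in_subspaceT => x /[!inE] Kx.
  by apply: differentiable_continuous; exact: dG.
have Nc : {within K, continuous (fun x => `|linfun ('d G x)|)}.
  apply: continuous_in_subspaceT => x /[!inE] Kx.
  apply/(@cvgrPdist_le _ _ _ (nbhs x)) => w w0.
  have := diff_near dGc w0 Kx; apply: filterS => y xy.
  rewrite (le_trans (ler_dist_dist _ _))// hom_norm_le ?(ltW w0)// => v.
  by rewrite linfunBE.
have [cM KcM GM] := compact_EVT_max K0 cK Gc.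
have [cm Kcm Gm] := compact_EVT_min K0 cK Gc.
have [cN KcN NN] := compact_EVT_min K0 cK Nc.
move: KcM Kcm KcN; rewrite !inE => KcM Kcm KcN.
exists (G cM), (G cm), `|linfun ('d G cN)|; split.
- split; first by exists cM => //; have [] := GF cM KcM.
  by move=> _ [x Kx <-]; have [<- _] := GF x Kx; apply: GM; rewrite inE.
- split; first by exists cm => //; have [] := GF cm Kcm.
  by move=> _ [x Kx <-]; have [<- _] := GF x Kx; apply: Gm; rewrite inE.
- split; first by exists cN => //; have [_ ->] := GF cN KcN.
  by move=> _ [x Kx <-]; have [_ <-] := GF x Kx; apply: NN; rewrite inE.
set m := `|linfun ('d G cN)|.
have mN x : K x -> m <= `|linfun ('d G x)|.
  by move=> Kx; apply: NN; rewrite inE.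
pose D := G cM - G cm.
have D0 : 0 <= D by rewrite subr_ge0; apply: GM; rewrite inE.
have Gb x : K x -> G cm <= G x <= G cM.
  by move=> Kx; rewrite Gm ?GM// inE.
have m0 : 0 <= m by exact: normr_ge0.
clearbody m; rewrite -/D; move: m0; rewrite le_eqVlt => /orP[/eqP <-|m0].
  by rewrite mule0 lee_fin.
set e := displacement_energy _.
have key (eta : R) : 0 < eta -> 2 * eta < m ->
    (e <= (2 * (D + 2 * eta) / (m - 2 * eta))%:E)%E.
  move=> eta0 etam.
  have Gle : G cm <= G cM by rewrite -subr_ge0.
  have [Phi [Ps [C cC P0] Pb dP]] :=
    smooth_C1_approx cK convK dG dGc Gle eta0 Gb.
  have me0 : 0 < m - 2 * eta by rewrite subr_gt0.
  (* [c * (m - eta) > 2], and the differential of [Phi] has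
     norm at least [m - eta] on [K] *)
  pose c := 2 / (m - 2 * eta); have c0 : 0 < c by rewrite divr_gt0.
  pose Psi (x : V) : R^o := c * Phi x.
  have Psis : smooth setT Psi by move=> j; apply: CkM => //; exact: Ck_cst.
  have dPsi x v : 'd Psi x v = c * 'd Phi x v.
    have Pd : differentiable Phi x by exact: smooth_differentiable.
    by rewrite -[Psi]/(c *: Phi) (diffZ c Pd).
  have -> : 2 * (D + 2 * eta) / (m - 2 * eta) = c * (D + eta) - c * (- eta).
    by rewrite /c; field; rewrite gt_eqF.
  have PsiE x : Psi x = c * Phi x by [].
  clearbody Psi.
  apply: (displacement_energy_le cK Psis cC).
  - by move=> x Cx; rewrite PsiE P0// mulr0.
  - by rewrite mulrN oppr_le0 mulr_ge0 ?(ltW c0) ?(ltW eta0).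
  - by rewrite mulr_ge0 ?(ltW c0)// addr_ge0 ?(ltW eta0).
  - move=> x; have /andP[h1 h2] := Pb x.
    by rewrite PsiE !ler_pM2l// h1 h2.
  move=> x Kx; have mx := mN x Kx.
  have -> : linfun ('d Psi x) = c *: linfun ('d Phi x).
    exact: (linfun_scale (dPsi x)).
  have gap : `|linfun ('d G x) - linfun ('d Phi x)| <= eta.
    apply: hom_norm_le => [|v]; first exact: ltW.
    by rewrite linfunBE distrC; exact: dP.
  move: mx gap; move: (linfun ('d G x)) (linfun ('d Phi x)) => p q mp pq.
  have qm : m - eta <= `|q|.
    rewrite lerBlDr (le_trans mp)// -[X in `|X|](subrK q) addrC.
    by rewrite (le_trans (ler_normD _ _))// lerD2l.
  rewrite normrZ gtr0_norm//.
  apply: (@lt_le_trans _ _ (c * (m - eta))); last by rewrite ler_pM2l.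
  rewrite /c mulrAC ltr_pdivlMr//; lra.
move: key; case: e => [r|/(_ (m / 4))|] key.
- rewrite -!EFinM lee_fin leNgt; apply/negP => Dr.
  have r0 : 0 < r.
    rewrite ltNge; apply/negP => r0; move: Dr; rewrite ltNge => /negP; apply.
    by rewrite (le_trans _ D0)// mulr_le0_ge0 ?(ltW m0)// mulr_ge0_le0.
  pose del := 2^-1 * r * m - D; have del0 : 0 < del by rewrite subr_gt0.
  (* [eta -> 0] in [key] would give [r * m <= 2 * D]; this [eta] is small enough *)
  pose eta := Num.min (m / 4) (del / (4 + 2 * r)).
  have r40 : 0 < 4 + 2 * r by lra.
  have eta0 : 0 < eta by rewrite lt_min !divr_gt0.
  have eta_m : eta <= m / 4 by rewrite ge_min lexx.
  have eta_del : eta * (4 + 2 * r) <= del.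
    by rewrite -ler_pdivlMr// ge_min lexx orbT.
  have etam : 2 * eta < m by lra.
  have := key eta eta0 etam; rewrite lee_fin ler_pdivlMr ?subr_gt0//.
  rewrite /del in del0 eta_del; nra.
- have m4 : 0 < m / 4 by rewrite divr_gt0.
  have m24 : 2 * (m / 4) < m by lra.
  by have := key m4 m24; rewrite leNgt ltry.
- by rewrite gt0_muleNy ?lte_fin ?invr_gt0// gt0_mulNye ?lte_fin// leNye.
Qed.
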